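(* Let $\alpha\in\mathbb{R}\setminus\mathbb{Q}$, let $v(x)=\sum_{1\le|j|\le M}\lambda_je^{2\pi ijx}$ with $\lambda_{-j}=\overline{\lambda_j}$, and let $c(x)=\sum_{k=N_1}^{N_2}\mu_ke^{2\pi ikx}$ with $N_1<N_2$, $\mu_{N_1}\mu_{N_2}\ne0$. Assume $N_2-N_1>2M$. Then for every $E\in\mathbb{R}$ there is $\epsilon_0\ge0$ such that $$L(\alpha,A^E_\epsilon)=\pi(N_2-N_1)|\epsilon|+\tfrac12\big(\log|\mu_{N_1}|+\log|\mu_{N_2}|\big)\quad\text{for all }|\epsilon|\ge\epsilon_0.$$ In particular $L(0;E)\ge\frac12(\log|\mu_{N_1}|+\log|\mu_{N_2}|)-I(c)$.
   Context: The Jacobi operator on $\ell^2(\mathbb{Z})$ is $(H\psi)_n=\overline{c(x+(n-1)\alpha)}\psi_{n-1}+c(x+n\alpha)\psi_{n+1}+v(x+n\alpha)\psi_n$. Let $\tilde c(z):=\sum_{k=N_1}^{N_2}\overline{\mu_k}e^{-2\pi ikz}$. The phase-complexified Jacobi cocycle is $(\alpha,A^E_\epsilon)$ with $A^E_\epsilon(x)=\begin{pmatrix}E-v(x+i\epsilon)&-\tilde c(x+i\epsilon-\alpha)\\ c(x+i\epsilon)&0\end{pmatrix}$; $L(\alpha,A^E_\epsilon)=\lim_n\frac1n\int_{\mathbb{R}/\mathbb{Z}}\log\|A^E_\epsilon(x+(n-1)\alpha)\cdots A^E_\epsilon(x)\|dx$. $I(c)=\int_{\mathbb{R}/\mathbb{Z}}\log|c(x)|dx$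 and $L(\epsilon;E)=L(\alpha,A^E_\epsilon)-I(c)$. *)

(* Defs.v *)
From Stdlib Require Import Reals Lra ZArith List.
Open Scope R_scope.

Definition CC : Type := (R * R)%type.
Definition Cre (z : CC) : R := fst z.
Definition Cim (z : CC) : R := snd z.
Definition C0 : CC := (0, 0).
Definition C1 : CC := (1, 0).
Definition RtoC (x : R) : CC := (x, 0).
Definition Cadd (z w : CC) : CC := (fst z + fst w, snd z + snd w).
Definition Copp (z : CC) : CC := (- fst z, - snd z).
Definition Csub (z w : CC) : CC := Cadd z (Copp w).
Definition Cmul (z w : CC) : CC :=
  (fst z * fst w - snd z * snd w, fst z * snd w + snd z * fst w).
Definition Cconj (z : CC) : CC := (fst z, - snd z).
Definition Cmod (z : CC) : R := sqrt (fst z * fst z + snd z * snd z).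
Definition Cexp (z : CC) : CC := (exp (fst z) * cos (snd z), exp (fst z) * sin (snd z)).

Definition zrange (a b : Z) : list Z :=
  List.map (fun n => (a + Z.of_nat n)%Z) (List.seq 0 (Z.to_nat (b - a + 1))).
Definition Csum (l : list Z) (f : Z -> CC) : CC :=
  List.fold_right (fun k acc => Cadd (f k) acc) C0 l.

Definition efun (k : Z) (z : CC) : CC := Cexp (Cmul (0, 2 * PI * IZR k) z).

Definition vpot (M : nat) (lam : Z -> CC) (z : CC) : CC :=
  Csum (List.filter (fun j => negb (Z.eqb j 0)) (zrange (- Z.of_nat M) (Z.of_nat M)))
       (fun j => Cmul (lam j) (efun j z)).
Definition cfun (N1 N2 : Z) (mu : Z -> CC) (z : CC) : CC :=
  Csum (zrange N1 N2) (fun k => Cmul (mu k) (efun k z)).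
Definition ctilde (N1 N2 : Z) (mu : Z -> CC) (z : CC) : CC :=
  Csum (zrange N1 N2) (fun k => Cmul (Cconj (mu k)) (efun (- k) z)).

Record M2 : Type := mkM2 { m11 : CC; m12 : CC; m21 : CC; m22 : CC }.
Definition M2id : M2 := mkM2 C1 C0 C0 C1.
Definition M2mul (A B : M2) : M2 :=
  mkM2 (Cadd (Cmul (m11 A) (m11 B)) (Cmul (m12 A) (m21 B)))
       (Cadd (Cmul (m11 A) (m12 B)) (Cmul (m12 A) (m22 B)))
       (Cadd (Cmul (m21 A) (m11 B)) (Cmul (m22 A) (m21 B)))
       (Cadd (Cmul (m21 A) (m12 B)) (Cmul (m22 A) (m22 B))).
(* operator norm (largest singular value) of a 2x2 complex matrix:
   ||A||^2 = (s + sqrt(s^2 - 4 |det A|^2)) / 2,  s = sum of |entries|^2 *)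
Definition M2norm (A : M2) : R :=
  let s := Rsqr (Cmod (m11 A)) + Rsqr (Cmod (m12 A)) + Rsqr (Cmod (m21 A)) + Rsqr (Cmod (m22 A)) in
  let d := Cmod (Csub (Cmul (m11 A) (m22 A)) (Cmul (m12 A) (m21 A))) in
  sqrt ((s + sqrt (Rsqr s - 4 * Rsqr d)) / 2).

Fixpoint cocycle (A : R -> M2) (alpha : R) (n : nat) (x : R) : M2 :=
  match n with
  | O => M2id
  | S m => M2mul (A (x + INR m * alpha)) (cocycle A alpha m x)
  end.

(* ---------- integral over R/Z = [0,1] of log g, g >= 0 ----------
   log g is bounded above but may equal -infinity (where g = 0), so its
   integral is defined by monotone convergence: I is the integral of log g
   iff the truncations log(max(g, e^{-K})) are Riemann integrable on [0,1]
   and their integrals converge to I as K -> infinity. *)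
Definition is_logint01 (g : R -> R) (I : R) : Prop :=
  exists J : nat -> R,
    (forall K : nat, exists pr : Riemann_integrable (fun x => ln (Rmax (g x) (exp (- INR K)))) 0 1,
        RiemannInt pr = J K) /\
    Un_cv J I.

Definition is_lyap (alpha : R) (A : R -> M2) (L : R) : Prop :=
  exists I : nat -> R,
    (forall n : nat, is_logint01 (fun x => M2norm (cocycle A alpha (S n) x)) (I n)) /\
    Un_cv (fun n => I n / INR (S n)) L.

Definition AJ (M : nat) (lam : Z -> CC) (N1 N2 : Z) (mu : Z -> CC) (alpha E eps : R) (x : R) : M2 :=
  mkM2 (Csub (RtoC E) (vpot M lam (x, eps)))
       (Copp (ctilde N1 N2 mu (x - alpha, eps)))
       (cfun N1 N2 mu (x, eps))
       C0.

Definition irrational (a : R) : Prop := forall (p q : Z), q <> 0%Z -> a <> IZR p / IZR q.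

(* Main.v *)
From Stdlib Require Import Reals ZArith Lra Lia List Permutation FunctionalExtensionality.
From Coquelicot Require Import Hierarchy Rcomplements RInt Continuity ElemFct.
Require Import Defs.
Open Scope R_scope.

(** Upper bound.  For [eps > 0] a diagonal gauge turns the cocycle into a polynomial [B(u)] in
    [u = exp (i pi (x + i eps))] with [B(0)] antidiagonal; the two-step cocycle is a polynomial
    whose constant term is a scalar [tau], [|tau| = |mu N1| |mu N2|].  Let [F_k] be the generating
    series, in the number [n] of steps, of the coefficient of [u^k] in the [n]-step product.  With
    [zeta = exp (2 i pi alpha)] the recursion reads
    [(1 - tau zeta^k X) F_k = X * (combination of F_j, j < k)], so [F_k] is a polynomial of size
    [Q^k] divided by [prod_(i <= k) (1 - tau zeta^i X)].  The coefficients of the reciprocal of this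
    product are complete homogeneous symmetric functions of [tau, tau zeta, ..., tau zeta^k]; their
    power sums are [O(|tau|^m)] uniformly in [k] because [zeta^m <> 1], and Newton's identities show
    that for every [theta < 1] these functions are [O(4^k (|tau| / theta)^n)].  Hence, on a disc of
    [u] that does not depend on [theta], the [n]-step product is [O((|tau| / theta)^n)], which
    bounds the exponent by its asymptotic value exactly, for every irrational [alpha].

    Lower bound.  [||A_n||^2 >= |det A_n|], and up to a unimodular factor and the growth
    [exp (2 pi (N2 - N1) eps n)] the determinant is a polynomial in [exp (2 i pi x)] with constant
    coefficient of modulus [|tau|^n], to which Jensen's inequality applies; this holds for all
    [eps], in particular [eps = 0].

    The case [eps < 0] follows by complex conjugation, which exchanges [(N1, N2)] and
    [(- N2, - N1)]. *)

(** * Arithmetic and moduli of complex numbers *)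

Lemma CC_ring_theory : ring_theory C0 C1 Cadd Cmul Csub Copp (@eq CC).
Proof.
split; intros; repeat match goal with z : CC |- _ => destruct z end;
  unfold Csub, Cadd, Cmul, Copp, C0, C1; simpl; f_equal; ring.
Qed.
Add Ring CC_ring : CC_ring_theory.

Fixpoint Cpow (z : CC) (n : nat) : CC :=
  match n with O => C1 | S m => Cmul z (Cpow z m) end.

Definition cis (y : R) : CC := (cos y, sin y).

Lemma cis_add x y : cis (x + y) = Cmul (cis x) (cis y).
Proof. unfold cis, Cmul; simpl. rewrite cos_plus, sin_plus. f_equal; ring. Qed.

Lemma cis_0 : cis 0 = C1.
Proof. unfold cis, C1. now rewrite cos_0, sin_0. Qed.

Lemma Cmod_ge_0 z : 0 <= Cmod z.
Proof. apply sqrt_pos. Qed.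

Lemma Cmod_sqr z : Cmod z * Cmod z = fst z * fst z + snd z * snd z.
Proof. unfold Cmod. apply sqrt_sqrt. nra. Qed.

Lemma Cmod_mul z w : Cmod (Cmul z w) = Cmod z * Cmod w.
Proof.
unfold Cmod. rewrite <- sqrt_mult_alt by nra. f_equal. unfold Cmul; simpl. ring.
Qed.

Lemma Cmod_add z w : Cmod (Cadd z w) <= Cmod z + Cmod w.
Proof.
assert (Hz := Cmod_ge_0 z). assert (Hw := Cmod_ge_0 w).
apply Rsqr_incr_0; [| apply Cmod_ge_0 | lra].
unfold Rsqr. rewrite (Cmod_sqr (Cadd z w)).
assert (H : (fst z * fst w + snd z * snd w) <= Cmod z * Cmod w).
{ rewrite <- Cmod_mul. unfold Cmod, Cmul; simpl.
  apply Rle_trans with (sqrt ((fst z * fst w + snd z * snd w) * (fst z * fst w + snd z * snd w))).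
  - change ((fst z * fst w + snd z * snd w) * (fst z * fst w + snd z * snd w))
      with (Rsqr (fst z * fst w + snd z * snd w)). rewrite sqrt_Rsqr_abs. apply Rle_abs.
  - apply sqrt_le_1_alt.
    apply Rminus_le. apply Ropp_le_cancel. rewrite Ropp_0.
    match goal with |- 0 <= ?t => replace t with (Rsqr (fst z * snd w - snd z * fst w)) end.
    + apply Rle_0_sqr.
    + unfold Rsqr. ring. }
assert (H1 := Cmod_sqr z). assert (H2 := Cmod_sqr w).
unfold Cadd; simpl. nra.
Qed.

Lemma Cmod_opp z : Cmod (Copp z) = Cmod z.
Proof. unfold Cmod, Copp; simpl. f_equal; ring. Qed.

Lemma Cmod_conj z : Cmod (Cconj z) = Cmod z.
Proof. unfold Cmod, Cconj; simpl. f_equal; ring. Qed.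

Lemma Cmod_sub z w : Cmod (Csub z w) <= Cmod z + Cmod w.
Proof. unfold Csub. rewrite <- (Cmod_opp w). apply Cmod_add. Qed.

Lemma Cmod_C0 : Cmod C0 = 0.
Proof. unfold Cmod, C0; simpl. replace (0 * 0 + 0 * 0) with 0 by ring. apply sqrt_0. Qed.

Lemma Cmod_C1 : Cmod C1 = 1.
Proof. unfold Cmod, C1; simpl. replace (1 * 1 + 0 * 0) with 1 by ring. apply sqrt_1. Qed.

Lemma Cmod_RtoC x : Cmod (RtoC x) = Rabs x.
Proof.
unfold Cmod, RtoC; simpl. rewrite <- sqrt_Rsqr_abs. f_equal. unfold Rsqr; ring.
Qed.

Lemma Cmod_cis y : Cmod (cis y) = 1.
Proof.
unfold Cmod, cis; simpl. rewrite <- sqrt_1. f_equal.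
assert (H := sin2_cos2 y). unfold Rsqr in H. lra.
Qed.

Lemma Cmod_pow z n : Cmod (Cpow z n) = Cmod z ^ n.
Proof. induction n; simpl; [apply Cmod_C1 | now rewrite Cmod_mul, IHn]. Qed.

Lemma Cmod_eq_0 z : Cmod z = 0 -> z = C0.
Proof.
intros H. assert (H1 := Cmod_sqr z). rewrite H in H1.
destruct z as [a b]; simpl in H1. unfold C0. f_equal; nra.
Qed.

Lemma Cmod_pos z : z <> C0 -> 0 < Cmod z.
Proof.
intros H. destruct (Cmod_ge_0 z) as [h | h]; [exact h |].
exfalso. apply H, Cmod_eq_0. now symmetry.
Qed.

Lemma Cpow_add z m n : Cpow z (m + n) = Cmul (Cpow z m) (Cpow z n).
Proof. induction m; simpl; [ring | rewrite IHm; ring]. Qed.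

Lemma Cpow_mulz z w n : Cpow (Cmul z w) n = Cmul (Cpow z n) (Cpow w n).
Proof. induction n; simpl; [ring | rewrite IHn; ring]. Qed.

Lemma Cpow_mul z m n : Cpow z (m * n) = Cpow (Cpow z m) n.
Proof.
induction n; simpl.
- now rewrite Nat.mul_0_r.
- rewrite Nat.mul_succ_r, Nat.add_comm, Cpow_add, IHn. ring.
Qed.

Lemma cis_pow y n : Cpow (cis y) n = cis (INR n * y).
Proof.
induction n; [simpl; now rewrite Rmult_0_l, cis_0 |].
rewrite S_INR. simpl. rewrite IHn, <- cis_add. f_equal. ring.
Qed.

(** * Sequences, Cauchy products and weighted norms *)

Definition tl (f : nat -> CC) : nat -> CC := fun n => f (S n).

(** Cauchy product, unrolled from the first factor so that inductions run with that factor replaced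
    by its tail. *)
Fixpoint conv (n : nat) (f g : nat -> CC) : CC :=
  match n with
  | O => Cmul (f O) (g O)
  | S m => Cadd (Cmul (f O) (g (S m))) (conv m (tl f) g)
  end.

Lemma conv_ext n : forall f f' g g' : nat -> CC,
  (forall i, (i <= n)%nat -> f i = f' i) -> (forall i, (i <= n)%nat -> g i = g' i) ->
  conv n f g = conv n f' g'.
Proof.
induction n; intros f f' g g' Hf Hg; simpl.
- rewrite Hf, Hg by lia. reflexivity.
- rewrite Hf, Hg by lia. f_equal. apply IHn; intros; unfold tl; [apply Hf | apply Hg]; lia.
Qed.

Lemma conv_last n : forall f g, conv (S n) f g = Cadd (Cmul (f (S n)) (g O)) (conv n f (tl g)).
Proof.
induction n; intros f g.
- simpl. unfold tl. ring.
- change (conv (S (S n)) f g) with (Cadd (Cmul (f O) (g (S (S n)))) (conv (S n) (tl f) g)).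
  rewrite IHn. simpl. unfold tl. ring.
Qed.

Lemma conv_add_l n : forall f f' g,
  conv n (fun i => Cadd (f i) (f' i)) g = Cadd (conv n f g) (conv n f' g).
Proof.
induction n; intros; simpl; [ring |].
change (tl (fun i => Cadd (f i) (f' i))) with (fun i => Cadd (tl f i) (tl f' i)).
rewrite IHn. ring.
Qed.

Lemma conv_scal_l n : forall a f g, conv n (fun i => Cmul a (f i)) g = Cmul a (conv n f g).
Proof.
induction n; intros; simpl; [ring |].
change (tl (fun i => Cmul a (f i))) with (fun i => Cmul a (tl f i)).
rewrite IHn. ring.
Qed.

Lemma conv_0_l n g : conv n (fun _ => C0) g = C0.
Proof.
induction n; simpl; [ring |].
change (tl (fun _ => C0)) with (fun _ : nat => C0). rewrite IHn. ring.
Qed.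

(* multiplication of a power series by [1 - z X] *)
Definition fac (z : CC) (f : nat -> CC) : nat -> CC :=
  fun n => match n with O => f O | S m => Csub (f (S m)) (Cmul z (f m)) end.

(** Both sides are the coefficient of [X ^ n] in [(1 - z X) f g]. *)
Lemma conv_fac n : forall z f g, conv n f (fac z g) = conv n (fac z f) g.
Proof.
destruct n; intros z f g; [simpl; ring |].
revert f. induction n; intros f.
- simpl. unfold tl, fac. ring.
- change (conv (S (S n)) f (fac z g))
    with (Cadd (Cmul (f O) (fac z g (S (S n)))) (conv (S n) (tl f) (fac z g))).
  rewrite IHn. simpl.
  change (tl (tl (fac z f))) with (tl (fac z (tl f))).
  unfold tl. simpl. ring.
Qed.

Lemma fac_comm z w f n : fac z (fac w f) n = fac w (fac z f) n.
Proof. destruct n as [| [| n]]; simpl; ring. Qed.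

(** Truncating the weighted l1 norm at [n] keeps every estimate finite: no convergence of the
    generating series at radius [rho] has to be known, and the bounds obtained are uniform in
    [n]. *)
Fixpoint nrm (rho : R) (n : nat) (f : nat -> CC) : R :=
  match n with
  | O => Cmod (f O)
  | S m => nrm rho m f + Cmod (f (S m)) * rho ^ (S m)
  end.

Lemma nrm_ge_0 rho n f : 0 <= rho -> 0 <= nrm rho n f.
Proof.
intros H. induction n; simpl; [apply Cmod_ge_0 |].
assert (H1 := pow_le rho (S n) H). simpl in H1. assert (H2 := Cmod_ge_0 (f (S n))). nra.
Qed.

Lemma nrm_add rho n f g : 0 <= rho ->
  nrm rho n (fun i => Cadd (f i) (g i)) <= nrm rho n f + nrm rho n g.
Proof.
intros H. induction n; simpl; [apply Cmod_add |].
assert (H1 := pow_le rho (S n) H). simpl in H1. assert (H2 := Cmod_add (f (S n)) (g (S n))). nra.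
Qed.

Lemma nrm_scal rho n a f : nrm rho n (fun i => Cmul a (f i)) = Cmod a * nrm rho n f.
Proof. induction n; simpl; rewrite Cmod_mul; [reflexivity |]. rewrite IHn. ring. Qed.

Lemma nrm_ext rho n f g : (forall i, f i = g i) -> nrm rho n f = nrm rho n g.
Proof. intros H. induction n; simpl; rewrite H; [reflexivity | now rewrite IHn]. Qed.

Definition shift (f : nat -> CC) : nat -> CC :=
  fun n => match n with O => C0 | S m => f m end.

Lemma nrm_mono rho n f : 0 <= rho -> nrm rho n f <= nrm rho (S n) f.
Proof.
intros H. change (nrm rho (S n) f) with (nrm rho n f + Cmod (f (S n)) * rho ^ (S n)).
assert (H1 := pow_le rho (S n) H). assert (H2 := Cmod_ge_0 (f (S n))). nra.
Qed.

Lemma nrm_shift_S rho n f : nrm rho (S n) (shift f) = rho * nrm rho n f.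
Proof.
induction n.
- simpl. rewrite Cmod_C0. ring.
- change (nrm rho (S (S n)) (shift f))
    with (nrm rho (S n) (shift f) + Cmod (f (S n)) * rho ^ (S (S n))).
  rewrite IHn. simpl. ring.
Qed.

Lemma nrm_shift rho n f : 0 <= rho -> nrm rho n (shift f) <= rho * nrm rho n f.
Proof.
intros H. rewrite <- nrm_shift_S. now apply nrm_mono.
Qed.

Lemma fac_shift_eq z f n : fac z f n = Cadd (f n) (Cmul (Copp z) (shift f n)).
Proof. destruct n; simpl; ring. Qed.

Lemma nrm_fac rho n z f : 0 <= rho -> nrm rho n (fac z f) <= (1 + Cmod z * rho) * nrm rho n f.
Proof.
intros H.
rewrite (nrm_ext _ _ _ _ (fac_shift_eq z f)).
eapply Rle_trans; [apply nrm_add; exact H |].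
rewrite nrm_scal, Cmod_opp.
assert (H1 := nrm_shift rho n f H). assert (H2 := Cmod_ge_0 z). nra.
Qed.

(** Duality of weighted l1 and sup norms: the size allowed for [h (n - i)] is
    [A * rho ^ i / rho ^ n], and [rho ^ i] is exactly the weight in [nrm]. *)
Lemma conv_bound rho A n : 0 < rho -> forall f h,
  (forall j, (j <= n)%nat -> Cmod (h j) <= A * / rho ^ j) ->
  Cmod (conv n f h) <= A * / rho ^ n * nrm rho n f.
Proof.
intros Hr f h Hh.
assert (Hpos : forall k, 0 < rho ^ k) by (intros; now apply pow_lt).
assert (G : forall m f, (m <= n)%nat ->
   Cmod (conv m f h) <= A * / rho ^ m * nrm rho m f).
{ clear f. induction m; intros f Hm.
  - simpl. rewrite Cmod_mul. assert (H := Hh O ltac:(lia)). simpl in H.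
    assert (H1 := Cmod_ge_0 (f O)). nra.
  - simpl conv. eapply Rle_trans; [apply Cmod_add |]. rewrite Cmod_mul.
    assert (IH := IHm (tl f) ltac:(lia)).
    assert (H0 := Hh (S m) Hm).
    (* [nrm] is built from the top coefficient and [conv] from the bottom one; [E] peels [nrm] from
       the bottom. *)
    assert (E : nrm rho (S m) f = Cmod (f O) + rho * nrm rho m (tl f)).
    { clear. induction m; [simpl; unfold tl; ring |].
      change (nrm rho (S (S m)) f) with (nrm rho (S m) f + Cmod (f (S (S m))) * rho ^ (S (S m))).
      rewrite IHm. simpl. unfold tl. ring. }
    rewrite E.
    replace (A * / rho ^ S m * (Cmod (f O) + rho * nrm rho m (tl f)))
      with (Cmod (f O) * (A * / rho ^ S m) + A * / rho ^ m * nrm rho m (tl f)).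
    2:{ simpl. field. split; [apply Rgt_not_eq, Hpos | lra]. }
    assert (H1 := Cmod_ge_0 (f O)). nra. }
now apply G.
Qed.

(** * Complete homogeneous symmetric functions *)

(** The inner recursion in [n] is division of the previous series by [1 - z k X]. *)
Fixpoint hsym (z : nat -> CC) (K : nat) : nat -> CC :=
  match K with
  | O => fun n => match n with O => C1 | S _ => C0 end
  | S k => fix g n :=
      match n with
      | O => hsym z k O
      | S m => Cadd (hsym z k (S m)) (Cmul (z k) (g m))
      end
  end.

Lemma hsym_S z K n :
  hsym z (S K) (S n) = Cadd (hsym z K (S n)) (Cmul (z K) (hsym z (S K) n)).
Proof. reflexivity. Qed.

Lemma hsym_0 z K : hsym z K 0 = C1.
Proof. induction K; [reflexivity | exact IHK]. Qed.

Lemma fac_hsym z K n : fac (z K) (hsym z (S K)) n = hsym z K n.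
Proof.
destruct n; [reflexivity |]. unfold fac. rewrite hsym_S. ring.
Qed.

Fixpoint facs (z : nat -> CC) (K : nat) (f : nat -> CC) : nat -> CC :=
  match K with O => f | S k => fac (z k) (facs z k f) end.

(* [hsym z K] is the power series of [1 / prod_(i < K) (1 - z_i X)] *)
Lemma facs_inv z K f n : f n = conv n (facs z K f) (hsym z K).
Proof.
revert n. induction K; intros n.
- change (facs z 0 f) with f. destruct n; [simpl; ring |].
  rewrite conv_last. change (tl (hsym z 0)) with (fun _ : nat => C0).
  assert (E : forall m f, conv m f (fun _ => C0) = C0).
  { clear. induction m; intros; simpl; [ring | rewrite IHm; ring]. }
  rewrite E. simpl. ring.
- change (facs z (S K) f) with (fac (z K) (facs z K f)).
  rewrite <- conv_fac, (IHK n). apply conv_ext; [reflexivity |].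
  intros i _. symmetry. apply fac_hsym.
Qed.

Fixpoint psum (z : nat -> CC) (K m : nat) : CC :=
  match K with O => C0 | S k => Cadd (psum z k m) (Cpow (z k) m) end.

Lemma conv_fac_expand n x f g :
  conv (S n) (fac x f) g = Csub (conv (S n) f g) (Cmul x (conv n f g)).
Proof.
rewrite (conv_ext (S n) (fac x f) (fun i => Cadd (f i) (Cmul (Copp x) (shift f i))) g g)
  by (intros; first [apply fac_shift_eq | reflexivity]).
rewrite conv_add_l, conv_scal_l.
change (conv (S n) (shift f) g) with (Cadd (Cmul C0 (g (S n))) (conv n f g)). ring.
Qed.

Lemma RtoC_S n : RtoC (INR (S n)) = Cadd (RtoC (INR n)) C1.
Proof. rewrite S_INR. unfold RtoC, Cadd, C1; simpl. f_equal; ring. Qed.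

(** Newton's identity, the logarithmic derivative of [1 / prod (1 - z_i X)]. A new variable
    [x = z K] adds a geometric sequence to the power sums. The identity for [K] variables is
    expressed through the new functions by moving [1 - x X] onto the power sums, and an inner
    induction on [n] closes the recursion. *)
Lemma hsym_newton z K n :
  Cmul (RtoC (INR (S n))) (hsym z K (S n)) = conv n (fun m => psum z K (S m)) (hsym z K).
Proof.
revert n. induction K; intros n.
- change (fun m => psum z 0 (S m)) with (fun _ : nat => C0). rewrite conv_0_l. simpl. ring.
- set (x := z K). set (pS := fun m => psum z K (S m)). set (h := hsym z (S K)).
  set (xS := fun m => Cmul x (Cpow x m)).
  assert (E1 : forall m g, conv m (fun m => psum z (S K) (S m)) g
      = Cadd (conv m pS g) (conv m xS g)) by (intros; apply (conv_add_l m pS xS g)).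
  assert (E2 : forall m g, conv (S m) xS g = Cadd (Cmul x (g (S m))) (Cmul x (conv m xS g))).
  { intros m g. change (conv (S m) xS g) with (Cadd (Cmul (xS O) (g (S m))) (conv m (fun i => Cmul x (xS i)) g)).
    rewrite conv_scal_l. unfold xS; simpl. ring. }
  assert (E3 : forall m, conv m pS (hsym z K) = conv m (fac x pS) h).
  { intros m. rewrite <- conv_fac. apply conv_ext; [reflexivity |].
    intros. symmetry. apply fac_hsym. }
  induction n.
  + rewrite E1. unfold h. rewrite hsym_S.
    specialize (IHK O). fold pS in IHK. rewrite RtoC_S in *.
    change (RtoC (INR 0)) with C0 in *. simpl conv in *. rewrite hsym_0 in *.
    change (hsym z (S K) 0) with (hsym z K 0). rewrite hsym_0.
    assert (Eh : hsym z K 1 = pS O).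
    { transitivity (Cmul (pS O) C1); [rewrite <- IHK |]; ring. }
    rewrite Eh.
    unfold xS, x; simpl. ring.
  + rewrite E1. fold h. unfold h at 1. rewrite hsym_S. fold h x.
    specialize (IHK (S n)). fold pS in IHK. rewrite E3, conv_fac_expand in IHK.
    rewrite E2. fold h in IHn. rewrite E1 in IHn.
    rewrite (RtoC_S (S n)) in *.
    transitivity (Cadd (Cmul (Cadd (RtoC (INR (S n))) C1) (hsym z K (S (S n))))
       (Cadd (Cmul x (h (S n))) (Cmul x (Cmul (RtoC (INR (S n))) (h (S n)))))); [ring |].
    rewrite IHK, IHn. ring.
Qed.

(** There is one monomial per multiset of size [n], at most [2 ^ (n + K)] in all; the proof follows
    the Pascal-type recursion [hsym_S]. *)
Lemma hsym_crude z T : (forall i, Cmod (z i) <= T) ->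
  forall K n, Cmod (hsym z K n) <= 2 ^ (n + K) * T ^ n.
Proof.
intros Hz.
assert (HT : 0 <= T) by (eapply Rle_trans; [apply Cmod_ge_0 | apply (Hz O)]).
induction K.
- destruct n; simpl; [rewrite Cmod_C1; lra |]. rewrite Cmod_C0.
  apply Rmult_le_pos; [| apply (pow_le T (S n) HT)].
  apply (pow_le 2 (S (n + 0))). lra.
- induction n.
  + rewrite hsym_0, Cmod_C1. change (T ^ 0) with 1. rewrite Rmult_1_r. apply pow_R1_Rle. lra.
  + rewrite hsym_S. eapply Rle_trans; [apply Cmod_add |]. rewrite Cmod_mul.
    replace (2 ^ (S n + S K) * T ^ S n)
      with (2 ^ (S n + K) * T ^ S n + T * (2 ^ (n + S K) * T ^ n)).
    * apply Rplus_le_compat; [apply IHK |].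
      apply Rmult_le_compat; auto using Cmod_ge_0.
    * replace (n + S K)%nat with (S n + K)%nat by lia.
      replace (S n + S K)%nat with (S (S n + K)) by lia. simpl. ring.
Qed.

Lemma psum_crude z T K m : (forall i, Cmod (z i) <= T) -> Cmod (psum z K m) <= INR K * T ^ m.
Proof.
intros Hz. induction K; [simpl; rewrite Cmod_C0; lra |].
rewrite S_INR. simpl psum. eapply Rle_trans; [apply Cmod_add |]. rewrite Cmod_pow.
assert (Cmod (z K) ^ m <= T ^ m) by (apply pow_incr; split; [apply Cmod_ge_0 | apply Hz]).
lra.
Qed.

(** A geometric progression of ratio [zeta ^ m], kept in product form so that no division occurs
    when the ratio is [1]. *)
Lemma psum_geom tau zeta K m :
  Cmul (psum (fun i => Cmul tau (Cpow zeta i)) K m) (Csub C1 (Cpow zeta m))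
  = Cmul (Cpow tau m) (Csub C1 (Cpow zeta (m * K))).
Proof.
induction K; simpl.
- rewrite Nat.mul_0_r. simpl. ring.
- rewrite Cpow_mulz. rewrite <- Cpow_mul.
  replace (m * S K)%nat with (m + K * m)%nat by lia. rewrite Cpow_add.
  replace (m * K)%nat with (K * m)%nat in IHK by lia.
  transitivity (Cadd (Cmul (psum (fun i => Cmul tau (Cpow zeta i)) K m) (Csub C1 (Cpow zeta m)))
    (Cmul (Cmul (Cpow tau m) (Cpow zeta (K * m))) (Csub C1 (Cpow zeta m)))); [ring |].
  rewrite IHK. ring.
Qed.

(** What matters is uniformity in [K]. The bound may be very large for some [m], since
    [|1 - zeta ^ m|] is only known to be nonzero. *)
Lemma psum_geom_bound tau zeta K m : Cmod zeta = 1 -> Cpow zeta m <> C1 ->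
  Cmod (psum (fun i => Cmul tau (Cpow zeta i)) K m)
  <= Cmod tau ^ m * (2 / Cmod (Csub C1 (Cpow zeta m))).
Proof.
intros Hz Hm.
assert (Hp : 0 < Cmod (Csub C1 (Cpow zeta m))).
{ apply Cmod_pos. intros H. apply Hm.
  transitivity (Csub C1 (Csub C1 (Cpow zeta m))); [ring | rewrite H; ring]. }
assert (E := f_equal Cmod (psum_geom tau zeta K m)). rewrite !Cmod_mul, Cmod_pow in E.
assert (H2 : Cmod (Csub C1 (Cpow zeta (m * K))) <= 2).
{ eapply Rle_trans; [apply Cmod_sub |]. rewrite Cmod_C1, Cmod_pow, Hz, pow1. lra. }
apply Rmult_le_reg_r with (Cmod (Csub C1 (Cpow zeta m))); [exact Hp |].
rewrite E. unfold Rdiv. rewrite Rmult_assoc, (Rmult_assoc 2), Rinv_l, Rmult_1_r by lra.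
apply Rmult_le_compat_l; [apply pow_le, Cmod_ge_0 | exact H2].
Qed.

Fixpoint rsum (n : nat) (f : nat -> R) : R :=
  match n with O => 0 | S m => rsum m f + f m end.

(* The Cauchy product of Newton's identity is controlled by splitting the power sums at a
   threshold [m0]: below it they are bounded independently of [K], above it the weights
   [theta ^ m] make the trivial bound [K] harmless. *)
Lemma weighted_sum_bound theta (c : nat -> R) : 0 < theta < 1 ->
  exists N0 : nat, forall (K : nat) (s : nat -> R),
  (forall m, 0 <= s m <= c m /\ s m <= INR K * theta ^ (S m)) ->
  forall n, rsum n s <= INR N0 + INR K.
Proof.
intros [H0 H1].
(* With [theta ^ m0 < 1 - theta], the tail of the geometric series beyond [m0] is at most [K]; [N0]
   will bound the first [m0] terms. *)
destruct (pow_lt_1_zero theta ltac:(rewrite Rabs_right; lra) (1 - theta) ltac:(lra)) as [m0 Hm0].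
specialize (Hm0 m0 (le_n _)).
assert (Hp0 : 0 < theta ^ m0) by now apply pow_lt.
rewrite Rabs_right in Hm0 by lra.
destruct (INR_unbounded (rsum m0 c)) as [N0 HN0].
exists N0. intros K s Hs n.
assert (HK := pos_INR K).
assert (Hlow : rsum m0 s <= rsum m0 c).
{ clear -Hs. induction m0; simpl; [lra |]. destruct (Hs m0) as [[_ h] _]. lra. }
assert (Hhigh : forall i, (1 - theta) * rsum (m0 + i) s
    <= (1 - theta) * rsum m0 s + INR K * theta ^ m0 * (1 - theta ^ i)).
{ induction i.
  - rewrite Nat.add_0_r. simpl. lra.
  - rewrite Nat.add_succ_r. simpl rsum. destruct (Hs (m0 + i)%nat) as [_ h].
    replace (theta ^ S (m0 + i)) with (theta * (theta ^ m0 * theta ^ i)) in h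
      by (simpl; rewrite pow_add; ring).
    simpl pow.
    assert (0 < theta ^ i) by now apply pow_lt.
    assert (hh : (1 - theta) * s (m0 + i)%nat <= (1 - theta) * (INR K * (theta ^ m0 * theta ^ i))).
    { apply Rmult_le_compat_l; [lra |]. eapply Rle_trans; [exact h |].
      apply Rmult_le_compat_l; [lra |].
      assert (0 < theta ^ m0 * theta ^ i) by nra. nra. }
    lra. }
assert (Hmono : forall i, rsum n s <= rsum (n + i) s).
{ induction i; [rewrite Nat.add_0_r; lra |]. rewrite Nat.add_succ_r. simpl.
  destruct (Hs (n + i)%nat) as [[h _] _]. lra. }
specialize (Hmono m0). rewrite Nat.add_comm in Hmono. specialize (Hhigh n).
assert (0 < theta ^ n) by now apply pow_lt.
assert (INR K * theta ^ m0 * (1 - theta ^ n) <= INR K * (1 - theta)).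
{ apply Rle_trans with (INR K * theta ^ m0 * 1).
  - apply Rmult_le_compat_l; [nra | lra].
  - rewrite Rmult_1_r. apply Rmult_le_compat_l; lra. }
apply Rle_trans with (rsum (m0 + n) s); [exact Hmono |].
assert ((1 - theta) * rsum (m0 + n) s <= (1 - theta) * (rsum m0 s + INR K)) by lra.
assert (rsum (m0 + n) s <= rsum m0 s + INR K) by (apply Rmult_le_reg_l with (1 - theta); lra).
lra.
Qed.

Lemma nrm_rsum rho n f : nrm rho n f = rsum (S n) (fun i => Cmod (f i) * rho ^ i).
Proof.
induction n; [simpl; ring |]. simpl nrm. rewrite IHn. reflexivity.
Qed.

(* The irrationality of the rotation enters here: [hsym] grows subexponentially in the
   number of variables relative to the trivial bound, up to the factor [4 ^ K]. *)
Lemma hsym_bound tau zeta theta : 0 < Cmod tau -> Cmod zeta = 1 ->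
  (forall m, Cpow zeta (S m) <> C1) -> 0 < theta < 1 ->
  exists C, 0 < C /\ forall K n,
  Cmod (hsym (fun i => Cmul tau (Cpow zeta i)) K n) <= C * 4 ^ K * / (theta / Cmod tau) ^ n.
Proof.
intros HT Hz Hirr Hth.
set (T := Cmod tau) in *. set (z := fun i => Cmul tau (Cpow zeta i)).
assert (Hzi : forall i, Cmod (z i) <= T).
{ intros i. unfold z. rewrite Cmod_mul, Cmod_pow, Hz, pow1. fold T. lra. }
destruct (weighted_sum_bound theta (fun m => 2 / Cmod (Csub C1 (Cpow zeta (S m)))) Hth) as [N0 HN0].
(* This weight turns the factor [T ^ m] of the power sums into [theta ^ m], as [weighted_sum_bound]
   requires. *)
set (rho := theta / T).
assert (Hrho : 0 < rho) by (apply Rdiv_lt_0_compat; lra).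
assert (HrT : rho * T = theta) by (unfold rho; field; lra).
(* For [n <= N0 + K] the crude factor satisfies [2 ^ (n + K) <= 2 ^ N0 * 4 ^ K]; beyond that range
   Newton's identity propagates the bound with the same constant. *)
exists (2 ^ N0). split; [apply pow_lt; lra |]. intros K n.
induction n as [n IH] using (well_founded_induction Wf_nat.lt_wf).
destruct (Nat.le_gt_cases n (N0 + K)) as [Hn | Hn].
- eapply Rle_trans; [apply (hsym_crude z T Hzi) |].
  assert (E : / rho ^ n = T ^ n * / theta ^ n).
  { unfold rho, Rdiv. rewrite Rpow_mult_distr, pow_inv. field. split; apply pow_nonzero; lra. }
  rewrite E.
  assert (Hi : 1 <= / theta ^ n).
  { rewrite <- Rinv_1. apply Rinv_le_contravar; [apply pow_lt; lra |].
    rewrite <- (pow1 n). apply pow_incr; lra. }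
  assert (HTn : 0 < T ^ n) by now apply pow_lt.
  assert (H2 : 2 ^ (n + K) <= 2 ^ N0 * 4 ^ K).
  { replace 4 with (2 ^ 2) by ring. rewrite <- pow_mult, <- pow_add.
    apply Rle_pow; [lra | lia]. }
  assert (H3 : 0 < 2 ^ N0 * 4 ^ K) by (apply Rmult_lt_0_compat; apply pow_lt; lra).
  apply Rle_trans with (2 ^ N0 * 4 ^ K * T ^ n).
  + apply Rmult_le_compat_r; lra.
  + rewrite <- (Rmult_1_r (2 ^ N0 * 4 ^ K * T ^ n)), !Rmult_assoc.
    do 2 (apply Rmult_le_compat_l; [apply pow_le; lra |]).
    apply Rmult_le_compat_l; lra.
- destruct n as [| n]; [lia |].
  assert (N := f_equal Cmod (hsym_newton z K n)).
  rewrite Cmod_mul, Cmod_RtoC, Rabs_right in N by (apply Rle_ge, pos_INR).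
  assert (B := conv_bound rho (2 ^ N0 * 4 ^ K) n Hrho (fun m => psum z K (S m)) (hsym z K)
    ltac:(intros; apply IH; lia)).
  rewrite <- N in B.
  (* This closes the strong induction: Newton's identity divides by [n + 1], and [N0 + K < n + 1] in
     this range. *)
  assert (W : rho * nrm rho n (fun m => psum z K (S m)) <= INR (S n)).
  { apply Rle_trans with (INR N0 + INR K).
    - rewrite nrm_rsum.
      apply Rle_trans with (rsum (S n) (fun i => rho * (Cmod (psum z K (S i)) * rho ^ i))).
      + generalize (S n). clear. intros n. induction n; simpl; lra.
      + apply HN0. intros m.
        assert (Hpm : 0 < rho ^ m) by now apply pow_lt.
        assert (E : forall a, rho * (T ^ S m * a * rho ^ m) = a * theta ^ S m).
        { intros a. rewrite <- HrT, Rpow_mult_distr. simpl. ring. }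
        assert (Ht1 : 0 < theta ^ S m <= 1).
        { split; [apply pow_lt; lra |]. rewrite <- (pow1 (S m)). apply pow_incr; lra. }
        assert (Hc : 0 <= 2 / Cmod (Csub C1 (Cpow zeta (S m)))).
        { apply Rlt_le, Rdiv_lt_0_compat; [lra |]. apply Cmod_pos. intros H. apply (Hirr m).
          transitivity (Csub C1 (Csub C1 (Cpow zeta (S m)))); [ring | rewrite H; ring]. }
        assert (G : forall a, Cmod (psum z K (S m)) <= T ^ S m * a ->
           rho * (Cmod (psum z K (S m)) * rho ^ m) <= a * theta ^ S m).
        { intros a Ha. rewrite <- E. apply Rmult_le_compat_l; [lra |].
          apply Rmult_le_compat_r; lra. }
        repeat split.
        * assert (h := Cmod_ge_0 (psum z K (S m))). apply Rmult_le_pos; [lra |].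
          apply Rmult_le_pos; lra.
        * eapply Rle_trans; [apply G, psum_geom_bound; auto |]. fold T. nra.
        * apply G. rewrite Rmult_comm. now apply psum_crude.
    - rewrite <- plus_INR. apply le_INR. lia. }
  assert (HSn : 0 < INR (S n)) by apply lt_0_INR, Nat.lt_0_succ.
  apply Rmult_le_reg_l with (INR (S n)); [exact HSn |].
  eapply Rle_trans; [exact B |].
  set (A := 2 ^ N0 * 4 ^ K) in *.
  assert (HA : 0 < A) by (apply Rmult_lt_0_compat; apply pow_lt; lra).
  replace (A * / rho ^ n * nrm rho n (fun m => psum z K (S m)))
    with (A * / rho ^ S n * (rho * nrm rho n (fun m => psum z K (S m)))).
  2:{ simpl. field. split; [apply pow_nonzero |]; lra. }
  rewrite (Rmult_comm (INR (S n))). apply Rmult_le_compat_l; [| exact W].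
  apply Rmult_le_pos; [lra |]. apply Rlt_le, Rinv_0_lt_compat, pow_lt, Hrho.
Qed.

(** * Weighted estimates for the generating series of the coefficients *)

Lemma facs_add z K f g :
  facs z K (fun n => Cadd (f n) (g n)) = fun n => Cadd (facs z K f n) (facs z K g n).
Proof.
induction K; [reflexivity |]. simpl. rewrite IHK.
extensionality n. destruct n; simpl; ring.
Qed.

Lemma facs_scal z K a f : facs z K (fun n => Cmul a (f n)) = fun n => Cmul a (facs z K f n).
Proof.
induction K; [reflexivity |]. simpl. rewrite IHK.
extensionality n. destruct n; simpl; ring.
Qed.

Lemma facs_fac z K w f : facs z K (fac w f) = fac w (facs z K f).
Proof.
induction K; [reflexivity |]. simpl. rewrite IHK.
extensionality n. apply fac_comm.
Qed.

Lemma facs_shift z K f : facs z K (shift f) = shift (facs z K f).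
Proof.
induction K; [reflexivity |]. simpl. rewrite IHK.
extensionality n. destruct n as [| [| n]]; simpl; ring.
Qed.

(** The pieces grow geometrically in [j] with ratio at least [2], so the last one dominates. The
    [- 1] lets the induction on [k] absorb the term of index [0]. *)
Lemma nrm_facs_conv rho N z K beta q : 0 <= rho -> 0 <= beta -> 2 <= q ->
  forall k A (Phi : nat -> nat -> CC) (t : nat -> CC), 0 <= A ->
  (forall j, (j <= k)%nat -> nrm rho N (facs z K (Phi j)) <= A * q ^ j) ->
  (forall i, Cmod (t i) <= beta) ->
  nrm rho N (facs z K (fun n => conv k (fun j => Phi j n) t)) <= A * beta * (2 * q ^ k - 1).
Proof.
intros Hr Hb Hq. induction k; intros A Phi t HA HPhi Ht.
- assert (E : (fun n => conv 0 (fun j => Phi j n) t) = fun n => Cmul (t O) (Phi O n)).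
  { extensionality n. simpl. ring. }
  rewrite E, facs_scal, nrm_scal. specialize (HPhi O ltac:(lia)). simpl in *.
  assert (H1 := nrm_ge_0 rho N (facs z K (Phi O)) Hr).
  assert (H2 := Cmod_ge_0 (t O)). specialize (Ht O). nra.
- assert (E : (fun n => conv (S k) (fun j => Phi j n) t)
    = fun n => Cadd (Cmul (t (S k)) (Phi O n)) (conv k (fun j => Phi (S j) n) t)).
  { extensionality n. simpl. unfold tl. ring. }
  rewrite E, facs_add. eapply Rle_trans; [apply nrm_add, Hr |].
  rewrite facs_scal, nrm_scal.
  assert (IH := IHk (A * q) (fun j => Phi (S j)) t ltac:(nra)).
  assert (H0 := HPhi O ltac:(lia)). simpl in H0.
  assert (H1 := nrm_ge_0 rho N (facs z K (Phi O)) Hr).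
  assert (H2 := Cmod_ge_0 (t (S k))). assert (H3 := Ht (S k)).
  assert (IH' : nrm rho N (facs z K (fun n => conv k (fun j => Phi (S j) n) t))
     <= A * q * beta * (2 * q ^ k - 1)).
  { apply IH; [| exact Ht]. intros j Hj. specialize (HPhi (S j) ltac:(lia)).
    simpl in HPhi. lra. }
  assert (H4 : Cmod (t (S k)) * nrm rho N (facs z K (Phi O)) <= beta * A).
  { apply Rmult_le_compat; lra. }
  assert (H5 : 0 <= A * beta) by nra.
  simpl pow. nra.
Qed.

(** Each further factor [1 - z_i X] costs at most [1 + T * rho <= 2]; this brings series with
    different denominators to a common one. *)
Lemma nrm_facs_weaken rho N z T f k i : 0 <= rho -> (forall i, Cmod (z i) <= T) -> T * rho <= 1 ->
  nrm rho N (facs z (k + i) f) <= 2 ^ i * nrm rho N (facs z k f).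
Proof.
intros Hr Hz HT. induction i; [rewrite Nat.add_0_r; simpl; lra |].
rewrite Nat.add_succ_r. simpl facs. eapply Rle_trans; [apply nrm_fac, Hr |].
assert (H := Hz (k + i)%nat).
assert (H0 := nrm_ge_0 rho N (facs z (k + i) f) Hr). simpl pow.
assert (1 + Cmod (z (k + i)%nat) * rho <= 2) by nra. nra.
Qed.

Definition twist (zeta : CC) (f : nat -> CC) : nat -> CC := fun i => Cmul (Cpow zeta i) (f i).

(* [f n k], [g n k] are the coefficients of [u ^ k] in a row of the [n]-fold product
   [B (zeta ^ (n - 1) u) ... B (zeta u) B u] *)
Definition row_rec (zeta : CC) (p11 p12 p21 p22 : nat -> CC) (f g : nat -> nat -> CC) : Prop :=
  forall n k,
    f (S n) k = Cadd (conv k (twist zeta (f n)) p11) (conv k (twist zeta (g n)) p21) /\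
    g (S n) k = Cadd (conv k (twist zeta (f n)) p12) (conv k (twist zeta (g n)) p22).

Section Rows.
Variables (tau zeta : CC) (beta : R) (p11 p12 p21 p22 : nat -> CC) (f g : nat -> nat -> CC).
Hypothesis Htau : 0 < Cmod tau.
Hypothesis Hzeta : Cmod zeta = 1.
Hypothesis Hrec : row_rec zeta p11 p12 p21 p22 f g.
Hypotheses (Hp11 : p11 0%nat = tau) (Hp12 : p12 0%nat = C0)
           (Hp21 : p21 0%nat = C0) (Hp22 : p22 0%nat = tau).
Hypotheses (Hb11 : forall i, Cmod (p11 i) <= beta) (Hb12 : forall i, Cmod (p12 i) <= beta)
           (Hb21 : forall i, Cmod (p21 i) <= beta) (Hb22 : forall i, Cmod (p22 i) <= beta).
Hypotheses (Hf0 : Cmod (f 0%nat 0%nat) <= 1) (Hg0 : Cmod (g 0%nat 0%nat) <= 1).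
Hypotheses (HfS : forall k, f 0%nat (S k) = C0) (HgS : forall k, g 0%nat (S k) = C0).

Let z := fun i => Cmul tau (Cpow zeta i).
Let F k : nat -> CC := fun n => f n k.
Let G k : nat -> CC := fun n => g n k.

(** Only the constant term of the matrix, the scalar [tau], acts in degree [0], so these
    coefficients are geometric sequences in [n]. *)
Lemma fac_F0 : fac (z 0) (F 0) = (fun n => match n with O => f 0%nat 0%nat | S _ => C0 end)
  /\ fac (z 0) (G 0) = (fun n => match n with O => g 0%nat 0%nat | S _ => C0 end).
Proof.
split; extensionality n; destruct n; try reflexivity; unfold fac, F, G, z;
  destruct (Hrec n O) as [E1 E2]; rewrite ?E1, ?E2; simpl; unfold twist; simpl.
- rewrite Hp11, Hp21. ring.
- rewrite Hp12, Hp22. ring.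
Qed.

(** In degree [k + 1] the term of top index carries the factor [tau zeta ^ (k + 1)] and moves to the
    left; the others involve only degrees [j <= k]. The shift records the step from [n] to [n + 1],
    the initial row being zero in positive degree. *)
Lemma fac_FS k :
  fac (z (S k)) (F (S k)) = shift (fun n =>
    Cadd (conv k (fun j => Cmul (Cpow zeta j) (F j n)) (tl p11))
         (conv k (fun j => Cmul (Cpow zeta j) (G j n)) (tl p21))) /\
  fac (z (S k)) (G (S k)) = shift (fun n =>
    Cadd (conv k (fun j => Cmul (Cpow zeta j) (F j n)) (tl p12))
         (conv k (fun j => Cmul (Cpow zeta j) (G j n)) (tl p22))).
Proof.
split; extensionality n; destruct n; unfold fac, shift; try (unfold F, G; now rewrite ?HfS, ?HgS);
  unfold F, G, z; destruct (Hrec n (S k)) as [E1 E2]; rewrite ?E1, ?E2;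
  rewrite !conv_last; rewrite ?Hp11, ?Hp12, ?Hp21, ?Hp22; unfold twist; ring.
Qed.

(** Strong induction on [k]. Bringing [F j] to the denominator of level [k] costs [2 ^ (k - j)], so
    the pieces grow like [(Q / 2) ^ j]; two convolutions and the shift give
    [4 * rho * beta * Q ^ k <= Q ^ (k + 1)]. *)
Lemma nrm_rows rho Q N : 0 <= rho -> Cmod tau * rho <= 1 -> 4 <= Q -> 4 * rho * beta <= Q ->
  forall k, nrm rho N (facs z (S k) (F k)) <= Q ^ k /\ nrm rho N (facs z (S k) (G k)) <= Q ^ k.
Proof.
intros Hr HT HQ HQb.
assert (Hb : 0 <= beta) by (eapply Rle_trans; [apply Cmod_ge_0 | apply (Hb11 O)]).
assert (Hz : forall i, Cmod (z i) <= Cmod tau).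
{ intros i. unfold z. rewrite Cmod_mul, Cmod_pow, Hzeta, pow1. lra. }
assert (Hd : forall a, nrm rho N (fun n => match n with O => a | S _ => C0 end) = Cmod a).
{ intros a. induction N; [reflexivity |]. simpl. rewrite IHN, Cmod_C0. ring. }
intros k. induction k as [k IH] using (well_founded_induction Wf_nat.lt_wf).
destruct k as [| k].
- destruct fac_F0 as [E1 E2]. simpl facs. rewrite E1, E2, !Hd. simpl. lra.
- destruct (fac_FS k) as [E1 E2].
  assert (Hj : forall X : nat -> nat -> CC,
     (forall j, (j < S k)%nat -> nrm rho N (facs z (S j) (X j)) <= Q ^ j) ->
     forall j, (j <= k)%nat ->
       nrm rho N (facs z (S k) (fun n => Cmul (Cpow zeta j) (X j n))) <= 2 ^ k * (Q / 2) ^ j).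
  { intros X HX j Hjk. rewrite facs_scal, nrm_scal, Cmod_pow, Hzeta, pow1, Rmult_1_l.
    replace (S k) with (S j + (k - j))%nat by lia.
    eapply Rle_trans; [apply (nrm_facs_weaken rho N z (Cmod tau)); auto |].
    replace (2 ^ k) with (2 ^ (k - j) * 2 ^ j) by (rewrite <- pow_add; f_equal; lia).
    rewrite Rmult_assoc, <- Rpow_mult_distr. replace (2 * (Q / 2)) with Q by field.
    apply Rmult_le_compat_l; [apply pow_le; lra | apply HX; lia]. }
  assert (HjF := Hj F ltac:(intros; now apply IH)).
  assert (HjG := Hj G ltac:(intros; now apply IH)).
  assert (C : forall X p, (forall j, (j <= k)%nat ->
       nrm rho N (facs z (S k) (fun n => Cmul (Cpow zeta j) (X j n))) <= 2 ^ k * (Q / 2) ^ j) ->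
     (forall i, Cmod (p i) <= beta) ->
     nrm rho N (facs z (S k) (fun n => conv k (fun j => Cmul (Cpow zeta j) (X j n)) (tl p)))
       <= 2 * beta * Q ^ k).
  { intros X p HX Hp.
    eapply Rle_trans; [apply (nrm_facs_conv rho N z (S k) beta (Q / 2)) with (A := 2 ^ k); auto |].
    - lra.
    - apply pow_le; lra.
    - intros i. apply Hp.
    - replace (2 * beta * Q ^ k) with (2 ^ k * beta * (2 * (Q / 2) ^ k)).
      + apply Rmult_le_compat_l; [| lra]. apply Rmult_le_pos; [apply pow_le |]; lra.
      + replace (Q ^ k) with ((2 * (Q / 2)) ^ k) by (f_equal; field).
        rewrite Rpow_mult_distr. ring. }
  assert (D : forall X Y p p', (forall j, (j <= k)%nat ->
       nrm rho N (facs z (S k) (fun n => Cmul (Cpow zeta j) (X j n))) <= 2 ^ k * (Q / 2) ^ j) ->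
       (forall j, (j <= k)%nat ->
       nrm rho N (facs z (S k) (fun n => Cmul (Cpow zeta j) (Y j n))) <= 2 ^ k * (Q / 2) ^ j) ->
     (forall i, Cmod (p i) <= beta) -> (forall i, Cmod (p' i) <= beta) ->
     nrm rho N (facs z (S k) (shift (fun n =>
        Cadd (conv k (fun j => Cmul (Cpow zeta j) (X j n)) (tl p))
             (conv k (fun j => Cmul (Cpow zeta j) (Y j n)) (tl p'))))) <= Q ^ S k).
  { intros X Y p p' HX HY Hp Hp'. rewrite facs_shift.
    eapply Rle_trans; [apply nrm_shift, Hr |].
    rewrite facs_add.
    apply Rle_trans with (rho * (2 * beta * Q ^ k + 2 * beta * Q ^ k)).
    - apply Rmult_le_compat_l; [exact Hr |].
      eapply Rle_trans; [apply nrm_add, Hr |].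
      apply Rplus_le_compat; apply C; auto.
    - assert (0 <= Q ^ k) by (apply pow_le; lra). simpl. nra. }
  change (facs z (S (S k)) (F (S k))) with (fac (z (S k)) (facs z (S k) (F (S k)))).
  change (facs z (S (S k)) (G (S k))) with (fac (z (S k)) (facs z (S k) (G (S k)))).
  rewrite <- !facs_fac, E1, E2. split; apply D; auto.
Qed.

(** Dividing by [k + 1] linear factors costs [4 ^ (k + 1)] through [hsym_bound], hence the base
    [4 * Q]. The conditions on [Q] do not involve [theta], so the disc in [u] is the same for every
    [theta]; only [C] varies. *)
Lemma rows_bound theta Q : (forall m, Cpow zeta (S m) <> C1) -> 0 < theta < 1 ->
  4 <= Q -> 4 * beta <= Q * Cmod tau ->
  exists C, 0 < C /\ forall n k,
   Cmod (f n k) <= C * / (theta / Cmod tau) ^ n * (4 * Q) ^ k /\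
   Cmod (g n k) <= C * / (theta / Cmod tau) ^ n * (4 * Q) ^ k.
Proof.
intros Hirr Hth HQ HQb.
assert (Hr : 0 < theta / Cmod tau) by (apply Rdiv_lt_0_compat; lra).
assert (Hb : 0 <= beta) by (eapply Rle_trans; [apply Cmod_ge_0 | apply (Hb11 O)]).
destruct (hsym_bound tau zeta theta Htau Hzeta Hirr Hth) as [C [HC B]]. fold z in B.
exists (C * 4). split; [lra |]. intros n k.
assert (HT1 : Cmod tau * (theta / Cmod tau) = theta) by (field; lra).
assert (HQr : 4 * (theta / Cmod tau) * beta <= Q).
{ apply Rmult_le_reg_r with (Cmod tau); [exact Htau |].
  replace (4 * (theta / Cmod tau) * beta * Cmod tau) with (theta * (4 * beta)) by (field; lra).
  nra. }
assert (X : forall X : nat -> CC, nrm (theta / Cmod tau) n (facs z (S k) X) <= Q ^ k ->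
   Cmod (X n) <= C * 4 * / (theta / Cmod tau) ^ n * (4 * Q) ^ k).
{ intros X HX. rewrite (facs_inv z (S k) X n).
  eapply Rle_trans; [apply (conv_bound (theta / Cmod tau) (C * 4 ^ S k)); auto |].
  rewrite Rpow_mult_distr.
  replace (C * 4 * / (theta / Cmod tau) ^ n * (4 ^ k * Q ^ k))
    with (C * 4 ^ S k * / (theta / Cmod tau) ^ n * Q ^ k) by (simpl; ring).
  apply Rmult_le_compat_l; [| exact HX].
  apply Rmult_le_pos; [apply Rmult_le_pos; [lra | apply pow_le; lra] |].
  apply Rlt_le, Rinv_0_lt_compat, pow_lt, Hr. }
destruct (nrm_rows (theta / Cmod tau) Q n ltac:(lra) ltac:(lra) HQ HQr k) as [H1 H2].
split; [exact (X (F k) H1) | exact (X (G k) H2)].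
Qed.
End Rows.

(** * Polynomials in an exponential *)

Fixpoint pev (d : nat) (p : nat -> CC) (u : CC) : CC :=
  match d with O => p O | S e => Cadd (p O) (Cmul u (pev e (tl p) u)) end.

Definition deg_le (p : nat -> CC) (d : nat) : Prop := forall k, (d < k)%nat -> p k = C0.

Lemma pev_ext d : forall p q u, (forall i, p i = q i) -> pev d p u = pev d q u.
Proof.
induction d; intros p q u H; simpl; rewrite H; [reflexivity |].
rewrite (IHd (tl p) (tl q)); [reflexivity | intros; apply H].
Qed.

Lemma pev_0 d : forall u, pev d (fun _ => C0) u = C0.
Proof.
induction d; intros; simpl; [reflexivity |].
change (tl (fun _ => C0)) with (fun _ : nat => C0). rewrite IHd. ring.
Qed.

Lemma pev_add d : forall p q u, pev d (fun i => Cadd (p i) (q i)) u = Cadd (pev d p u) (pev d q u).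
Proof.
induction d; intros; simpl; [reflexivity |].
change (tl (fun i => Cadd (p i) (q i))) with (fun i => Cadd (tl p i) (tl q i)).
rewrite IHd. ring.
Qed.

Lemma pev_scal d : forall a p u, pev d (fun i => Cmul a (p i)) u = Cmul a (pev d p u).
Proof.
induction d; intros; simpl; [reflexivity |].
change (tl (fun i => Cmul a (p i))) with (fun i => Cmul a (tl p i)).
rewrite IHd. ring.
Qed.

Lemma deg_le_tl p d : deg_le p (S d) -> deg_le (tl p) d.
Proof. intros H k Hk. apply H. lia. Qed.

Lemma deg_le_mono p d e : deg_le p d -> (d <= e)%nat -> deg_le p e.
Proof. intros H He k Hk. apply H. lia. Qed.

Lemma pev_deg d : forall p e u, deg_le p d -> (d <= e)%nat -> pev e p u = pev d p u.
Proof.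
induction d; intros p e u H He.
- destruct e; [reflexivity |]. simpl.
  rewrite (pev_ext e (tl p) (fun _ => C0)) by (intros; apply H; lia).
  rewrite pev_0. ring.
- destruct e; [lia |]. simpl. rewrite (IHd (tl p) e u); [reflexivity | now apply deg_le_tl | lia].
Qed.

Lemma deg_le_conv d : forall p q e, deg_le p d -> deg_le q e -> deg_le (fun n => conv n p q) (d + e).
Proof.
intros p q e Hp Hq n. revert d p Hp. induction n; intros d p Hp Hn; [lia |].
simpl. rewrite Hq by lia.
destruct d.
- rewrite (conv_ext n (tl p) (fun _ => C0) q q); [| intros; apply Hp; lia | reflexivity].
  rewrite conv_0_l. ring.
- rewrite (IHn d (tl p)); [ring | now apply deg_le_tl | lia].
Qed.

Lemma pev_conv d : forall p q e u, deg_le p d -> deg_le q e ->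
  pev (d + e) (fun n => conv n p q) u = Cmul (pev d p u) (pev e q u).
Proof.
induction d; intros p q e u Hp Hq.
- simpl. rewrite <- pev_scal. apply pev_ext. intros [| n]; simpl; [ring |].
  rewrite (conv_ext n (tl p) (fun _ => C0) q q); [| intros; apply Hp; lia | reflexivity].
  rewrite conv_0_l. ring.
- simpl plus. simpl pev.
  change (tl (fun n => conv n p q))
    with (fun n => Cadd (Cmul (p O) (tl q n)) (conv n (tl p) q)).
  rewrite pev_add, pev_scal, IHd; [| now apply deg_le_tl | exact Hq].
  assert (E := pev_deg e q (S (d + e)) u Hq ltac:(lia)). simpl in E.
  rewrite <- E. ring.
Qed.

(** Dilation of the variable is how a rotation of the phase acts on coefficients. *)
Lemma pev_twist d : forall zeta p u, pev d (twist zeta p) u = pev d p (Cmul zeta u).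
Proof.
induction d; intros; simpl; [unfold twist; simpl; ring |].
rewrite (pev_ext d (tl (twist zeta p)) (fun i => Cmul zeta (twist zeta (tl p) i)))
  by (intros; unfold tl, twist; simpl; ring).
rewrite pev_scal, IHd. unfold twist. simpl. ring.
Qed.

Lemma deg_le_twist zeta p d : deg_le p d -> deg_le (twist zeta p) d.
Proof. intros H k Hk. unfold twist. rewrite H by exact Hk. ring. Qed.

(** Geometric series of ratio at most [1 / 2]; the bound is independent of the degree, which in the
    application grows with the number of steps. *)
Lemma pev_bound d : forall A q p u, 0 <= A -> 0 <= q -> q * Cmod u <= / 2 ->
  (forall k, Cmod (p k) <= A * q ^ k) -> Cmod (pev d p u) <= 2 * A.
Proof.
induction d; intros A q p u HA Hq Hu Hp; simpl.
- specialize (Hp O). simpl in Hp. lra.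
- eapply Rle_trans; [apply Cmod_add |]. rewrite Cmod_mul.
  assert (H0 := Hp O). simpl in H0.
  assert (IH := IHd (A * q) q (tl p) u ltac:(nra) Hq Hu).
  assert (H1 : Cmod (pev d (tl p) u) <= 2 * (A * q)).
  { apply IH. intros k. specialize (Hp (S k)). simpl in Hp. unfold tl. lra. }
  assert (H2 := Cmod_ge_0 u). nra.
Qed.

Lemma deg_le_bounded d : forall p, deg_le p d -> exists beta, forall i, Cmod (p i) <= beta.
Proof.
induction d; intros p H.
- exists (Cmod (p O)). intros [| i]; [lra |].
  rewrite (H (S i)), Cmod_C0 by lia. apply Cmod_ge_0.
- destruct (IHd (tl p) (deg_le_tl p d H)) as [b Hb].
  exists (Rmax (Cmod (p O)) b). intros [| i]; [apply Rmax_l |].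
  eapply Rle_trans; [apply Hb | apply Rmax_r].
Qed.

(* [em m eps x] is [exp (i pi m (x + i eps))] *)
Definition em (m : Z) (eps x : R) : CC :=
  Cmul (RtoC (exp (- (PI * IZR m * eps)))) (cis (PI * IZR m * x)).

Lemma RtoC_mul a b : RtoC (a * b) = Cmul (RtoC a) (RtoC b).
Proof. unfold RtoC, Cmul; simpl. f_equal; ring. Qed.

Lemma em_add m m' eps x : em (m + m') eps x = Cmul (em m eps x) (em m' eps x).
Proof.
unfold em. rewrite plus_IZR.
replace (- (PI * (IZR m + IZR m') * eps)) with (- (PI * IZR m * eps) + - (PI * IZR m' * eps)) by ring.
rewrite exp_plus, RtoC_mul.
replace (PI * (IZR m + IZR m') * x) with (PI * IZR m * x + PI * IZR m' * x) by ring.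
rewrite cis_add. ring.
Qed.

Lemma em_0 eps x : em 0 eps x = C1.
Proof.
unfold em. rewrite Rmult_0_r, !Rmult_0_l, Ropp_0, exp_0, cis_0.
unfold RtoC, Cmul, C1; simpl. f_equal; ring.
Qed.

Lemma em_shift m eps x a : em m eps (x + a) = Cmul (cis (PI * IZR m * a)) (em m eps x).
Proof. unfold em. rewrite Rmult_plus_distr_l, cis_add. ring. Qed.

Lemma Cmod_em m eps x : Cmod (em m eps x) = exp (- (PI * IZR m * eps)).
Proof.
unfold em. rewrite Cmod_mul, Cmod_cis, Cmod_RtoC, Rmult_1_r. apply Rabs_right.
apply Rle_ge, Rlt_le, exp_pos.
Qed.

Lemma em_mul_nat h n eps x : em (h * Z.of_nat n) eps x = Cpow (em h eps x) n.
Proof.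
induction n; [now rewrite Z.mul_0_r, em_0 |].
replace (h * Z.of_nat (S n))%Z with (h + h * Z.of_nat n)%Z by lia.
rewrite em_add, IHn. reflexivity.
Qed.

Lemma efun_em k x eps : efun k (x, eps) = em (2 * k) eps x.
Proof.
unfold em. rewrite mult_IZR. unfold efun, Cexp, cis, Cmul, RtoC; cbn [fst snd].
replace (0 * x - 2 * PI * IZR k * eps) with (- (PI * (2 * IZR k) * eps)) by ring.
replace (0 * eps + 2 * PI * IZR k * x) with (PI * (2 * IZR k) * x) by ring.
f_equal; ring.
Qed.

(* polynomials in [em h eps x], with coefficients independent of [eps] and [x], and with
   prescribed constant coefficient *)
Definition Rep (h : Z) (g : R -> R -> CC) (c0 : CC) : Prop :=
  exists d p, deg_le p d /\ p O = c0 /\ forall eps x, g eps x = pev d p (em h eps x).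

Lemma Rep_ext h g g' c : (forall eps x, g eps x = g' eps x) -> Rep h g c -> Rep h g' c.
Proof.
intros H [d [p [H1 [H2 H3]]]]. exists d, p. repeat split; auto.
intros. now rewrite <- H, H3.
Qed.

Lemma Rep_add h g g' c c' : Rep h g c -> Rep h g' c' ->
  Rep h (fun eps x => Cadd (g eps x) (g' eps x)) (Cadd c c').
Proof.
intros [d [p [H1 [H2 H3]]]] [d' [p' [H1' [H2' H3']]]].
exists (d + d')%nat, (fun i => Cadd (p i) (p' i)). repeat split.
- intros k Hk. rewrite H1, H1' by lia. ring.
- now rewrite H2, H2'.
- intros. rewrite pev_add, (pev_deg d p (d + d')), (pev_deg d' p' (d + d')), H3, H3' by (auto; lia).
  reflexivity.
Qed.

Lemma Rep_mul h g g' c c' : Rep h g c -> Rep h g' c' ->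
  Rep h (fun eps x => Cmul (g eps x) (g' eps x)) (Cmul c c').
Proof.
intros [d [p [H1 [H2 H3]]]] [d' [p' [H1' [H2' H3']]]].
exists (d + d')%nat, (fun n => conv n p p'). repeat split.
- now apply deg_le_conv.
- simpl. now rewrite H2, H2'.
- intros. rewrite pev_conv by auto. now rewrite H3, H3'.
Qed.

Lemma Rep_const h c : Rep h (fun _ _ => c) c.
Proof.
exists O, (fun i => match i with O => c | S _ => C0 end). repeat split.
intros [| k] Hk; [lia | reflexivity].
Qed.

Lemma Rep_em h j : (0 < j)%Z -> Rep h (fun eps x => em (h * j) eps x) C0.
Proof.
intros Hj. replace j with (Z.of_nat (S (Z.to_nat j - 1))) by lia.
set (n := (Z.to_nat j - 1)%nat). clearbody n.
exists (S n), (fun i => if Nat.eqb i (S n) then C1 else C0). repeat split.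
- intros k Hk. replace (Nat.eqb k (S n)) with false; [reflexivity |].
  symmetry. apply Nat.eqb_neq. lia.
- intros. rewrite em_mul_nat. generalize (S n) (em h eps x). clear. intros n u.
  induction n; simpl; [reflexivity |]. rewrite IHn.
  rewrite (pev_ext n (tl _) (fun i => if Nat.eqb i n then C1 else C0)) by reflexivity. ring.
Qed.

Lemma Rep_monomial h a j : (0 <= j)%Z ->
  Rep h (fun eps x => Cmul a (em (h * j) eps x)) (if Z.eqb j 0 then a else C0).
Proof.
intros Hj. destruct (Z.eqb_spec j 0) as [-> | H].
- apply Rep_ext with (fun _ _ => a); [| apply Rep_const].
  intros. rewrite Z.mul_0_r, em_0. ring.
- replace C0 with (Cmul a C0) by ring.
  apply Rep_mul; [apply Rep_const | apply Rep_em; lia].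
Qed.

(** A translation in [x] multiplies [em h] by a constant, which leaves the coefficient of degree [0]
    alone. *)
Lemma Rep_shift h g c a : Rep h g c -> Rep h (fun eps x => g eps (x + a)) c.
Proof.
intros [d [p [H1 [H2 H3]]]]. exists d, (twist (cis (PI * IZR h * a)) p). repeat split.
- now apply deg_le_twist.
- unfold twist. simpl. rewrite H2. ring.
- intros. rewrite H3, pev_twist, em_shift. reflexivity.
Qed.

Lemma Rep_Csum h (l : list Z) g c : (forall k, In k l -> Rep h (g k) (c k)) ->
  Rep h (fun eps x => Csum l (fun k => g k eps x)) (Csum l c).
Proof.
induction l; intros H; simpl.
- apply (Rep_const h C0).
- apply Rep_add; [apply H; now left | apply IHl; intros; apply H; now right].
Qed.

Lemma Csum_ext l f g : (forall k, In k l -> f k = g k) -> Csum l f = Csum l g.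
Proof.
induction l; intros H; simpl; [reflexivity |].
rewrite (H a) by now left. rewrite IHl; [reflexivity | intros; apply H; now right].
Qed.

Lemma Csum_mul l a f : Cmul a (Csum l f) = Csum l (fun k => Cmul a (f k)).
Proof. induction l; simpl; [ring | rewrite <- IHl; ring]. Qed.

Lemma Csum_C0 l : Csum l (fun _ => C0) = C0.
Proof. induction l; simpl; [reflexivity | rewrite IHl; ring]. Qed.

Lemma Csum_single l a f : NoDup l -> In a l ->
  (forall k, In k l -> k <> a -> f k = C0) -> Csum l f = f a.
Proof.
induction l as [| b l IH]; intros HN Hin H; [destruct Hin |].
inversion HN as [| ? ? Hb HN']; subst. simpl. destruct Hin as [-> | Hin].
- rewrite (Csum_ext l f (fun _ => C0)), Csum_C0; [ring |].
  intros k Hk. apply H; [now right |]. intros ->. contradiction.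
- rewrite IH; auto.
  + rewrite (H b); [ring | now left |]. intros ->. contradiction.
  + intros. apply H; [now right | assumption].
Qed.

Lemma In_zrange a b k : In k (zrange a b) <-> (a <= k <= b)%Z.
Proof.
unfold zrange. rewrite in_map_iff. split.
- intros [n [<- Hn]]. apply in_seq in Hn. lia.
- intros H. exists (Z.to_nat (k - a)). split; [lia |]. apply in_seq. lia.
Qed.

Lemma NoDup_zrange a b : NoDup (zrange a b).
Proof.
unfold zrange. apply FinFun.Injective_map_NoDup; [| apply seq_NoDup].
intros m n H. lia.
Qed.

(** * Two by two matrices *)

(** A submultiplicative majorant of the operator norm; constant factors do not affect the
    exponent. *)
Definition msum (A : M2) : R := Cmod (m11 A) + Cmod (m12 A) + Cmod (m21 A) + Cmod (m22 A).
Definition M2det (A : M2) : CC := Csub (Cmul (m11 A) (m22 A)) (Cmul (m12 A) (m21 A)).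
Definition M2scal (a : CC) (A : M2) : M2 :=
  mkM2 (Cmul a (m11 A)) (Cmul a (m12 A)) (Cmul a (m21 A)) (Cmul a (m22 A)).

Lemma M2mul_assoc A B C : M2mul A (M2mul B C) = M2mul (M2mul A B) C.
Proof. unfold M2mul; simpl. f_equal; ring. Qed.

Lemma M2mul_id_l A : M2mul M2id A = A.
Proof. destruct A. unfold M2mul, M2id; simpl. f_equal; ring. Qed.

Lemma M2mul_id_r A : M2mul A M2id = A.
Proof. destruct A. unfold M2mul, M2id; simpl. f_equal; ring. Qed.

Lemma M2det_mul A B : M2det (M2mul A B) = Cmul (M2det A) (M2det B).
Proof. unfold M2det, M2mul; simpl. ring. Qed.

Lemma msum_ge_0 A : 0 <= msum A.
Proof.
unfold msum. repeat apply Rplus_le_le_0_compat; apply Cmod_ge_0.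
Qed.

Lemma msum_mul A B : msum (M2mul A B) <= msum A * msum B.
Proof.
unfold msum, M2mul; simpl.
assert (H : forall a b c d, Cmod (Cadd (Cmul a b) (Cmul c d)) <= Cmod a * Cmod b + Cmod c * Cmod d).
{ intros. eapply Rle_trans; [apply Cmod_add |]. rewrite !Cmod_mul. lra. }
destruct A as [a b c d], B as [a' b' c' d']; simpl.
assert (H1 := H a a' b c'). assert (H2 := H a b' b d').
assert (H3 := H c a' d c'). assert (H4 := H c b' d d').
assert (Ha := Cmod_ge_0 a). assert (Hb := Cmod_ge_0 b). assert (Hc := Cmod_ge_0 c).
assert (Hd := Cmod_ge_0 d). assert (Ha' := Cmod_ge_0 a'). assert (Hb' := Cmod_ge_0 b').
assert (Hc' := Cmod_ge_0 c'). assert (Hd' := Cmod_ge_0 d').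
assert (forall x y, 0 <= x -> 0 <= y -> 0 <= x * y) by (intros; nra).
repeat rewrite ?Rmult_plus_distr_l, ?Rmult_plus_distr_r.
assert (0 <= Cmod a * Cmod c') by auto. assert (0 <= Cmod a * Cmod d') by auto.
assert (0 <= Cmod b * Cmod a') by auto. assert (0 <= Cmod b * Cmod b') by auto.
assert (0 <= Cmod c * Cmod c') by auto. assert (0 <= Cmod c * Cmod d') by auto.
assert (0 <= Cmod d * Cmod a') by auto. assert (0 <= Cmod d * Cmod b') by auto.
lra.
Qed.

Lemma msum_scal a A : msum (M2scal a A) = Cmod a * msum A.
Proof. unfold msum, M2scal; simpl. rewrite !Cmod_mul. ring. Qed.

Lemma M2norm_le_msum A : M2norm A <= msum A.
Proof.
unfold M2norm.
set (s := Rsqr (Cmod (m11 A)) + Rsqr (Cmod (m12 A)) + Rsqr (Cmod (m21 A)) + Rsqr (Cmod (m22 A))).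
set (d := Cmod (Csub (Cmul (m11 A) (m22 A)) (Cmul (m12 A) (m21 A)))). cbv zeta.
assert (Hs : 0 <= s) by (unfold s; repeat apply Rplus_le_le_0_compat; apply Rle_0_sqr).
assert (H1 : sqrt (Rsqr s - 4 * Rsqr d) <= s).
{ rewrite <- (sqrt_Rsqr s) at 2 by exact Hs. apply sqrt_le_1_alt.
  assert (H := Rle_0_sqr d). lra. }
rewrite <- (sqrt_Rsqr (msum A)) by apply msum_ge_0. apply sqrt_le_1_alt.
apply Rle_trans with s; [lra |].
unfold s, msum, Rsqr.
assert (Ha := Cmod_ge_0 (m11 A)). assert (Hb := Cmod_ge_0 (m12 A)).
assert (Hc := Cmod_ge_0 (m21 A)). assert (Hd := Cmod_ge_0 (m22 A)). nra.
Qed.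

(** The modulus of the determinant is the product of the two singular values; algebraically,
    [s >= 2 * |det|]. *)
Lemma Cmod_det_le A : Cmod (M2det A) <= Rsqr (M2norm A).
Proof.
unfold M2norm. fold (M2det A).
set (s := Rsqr (Cmod (m11 A)) + Rsqr (Cmod (m12 A)) + Rsqr (Cmod (m21 A)) + Rsqr (Cmod (m22 A))).
cbv zeta.
assert (Hs : 2 * Cmod (M2det A) <= s).
{ unfold M2det. assert (H := Cmod_sub (Cmul (m11 A) (m22 A)) (Cmul (m12 A) (m21 A))).
  rewrite !Cmod_mul in H.
  assert (H1 := Rle_0_sqr (Cmod (m11 A) - Cmod (m22 A))).
  assert (H2 := Rle_0_sqr (Cmod (m12 A) - Cmod (m21 A))).
  unfold s, Rsqr in *. lra. }
assert (H0 := Cmod_ge_0 (M2det A)).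
assert (H1 := sqrt_pos (Rsqr s - 4 * Rsqr (Cmod (M2det A)))).
rewrite Rsqr_sqrt; lra.
Qed.

(** Peels the factor applied first, so that a row vector is propagated by multiplication on the
    right. *)
Lemma cocycle_right A a n : forall x, cocycle A a (S n) x = M2mul (cocycle A a n (x + a)) (A x).
Proof.
induction n; intros x.
- simpl. rewrite Rmult_0_l, Rplus_0_r, M2mul_id_l, M2mul_id_r. reflexivity.
- change (cocycle A a (S (S n)) x) with (M2mul (A (x + INR (S n) * a)) (cocycle A a (S n) x)).
  rewrite IHn, M2mul_assoc. f_equal.
  change (cocycle A a (S n) (x + a)) with (M2mul (A (x + a + INR n * a)) (cocycle A a n (x + a))).
  f_equal. f_equal. rewrite S_INR. ring.
Qed.

Lemma cocycle_double A a n x :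
  cocycle A a (2 * n) x = cocycle (fun y => M2mul (A (y + a)) (A y)) (2 * a) n x.
Proof.
revert x. induction n; intros x; [reflexivity |].
replace (2 * S n)%nat with (S (S (2 * n))) by lia.
rewrite !cocycle_right, <- M2mul_assoc, <- IHn. f_equal. f_equal. ring.
Qed.

(** Coefficients of the row [(f0, g0)] times the [n]-step product. The factor peeled on the right
    sits at [x] and the others start at [x + a], hence the twist of the previous row. *)
Fixpoint rows (zeta : CC) (p11 p12 p21 p22 f0 g0 : nat -> CC) (n : nat) :
  (nat -> CC) * (nat -> CC) :=
  match n with
  | O => (f0, g0)
  | S m =>
      let r := rows zeta p11 p12 p21 p22 f0 g0 m in
      ((fun k => Cadd (conv k (twist zeta (fst r)) p11) (conv k (twist zeta (snd r)) p21)),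
       (fun k => Cadd (conv k (twist zeta (fst r)) p12) (conv k (twist zeta (snd r)) p22)))
  end.

Definition cst (c : CC) : nat -> CC := fun i => match i with O => c | S _ => C0 end.

Lemma Rep_bounded g c : Rep 1 g c ->
  exists b, forall eps x, exp (- (PI * eps)) <= / 2 -> Cmod (g eps x) <= b.
Proof.
intros [d [p [H1 [_ H3]]]]. destruct (deg_le_bounded d p H1) as [b Hb].
exists (2 * b). intros eps x He. rewrite H3.
assert (0 <= b) by (eapply Rle_trans; [apply Cmod_ge_0 | apply (Hb O)]).
apply (pev_bound d b 1); [assumption | lra | |].
- rewrite Cmod_em, !Rmult_1_r, Rmult_1_l. exact He.
- intros k. rewrite pow1, Rmult_1_r. apply Hb.
Qed.

Lemma exp_small_of_large r : 0 < r -> r <= 1 ->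
  exists e0, 0 <= e0 /\ forall eps, e0 <= eps -> exp (- (PI * eps)) <= r.
Proof.
intros Hr Hr1. assert (HP := PI_RGT_0). exists (- ln r / PI). split.
- apply Rmult_le_pos; [| apply Rlt_le, Rinv_0_lt_compat, HP].
  assert (ln r <= 0); [| lra]. rewrite <- ln_1. destruct Hr1 as [H | ->]; [| lra].
  apply Rlt_le, ln_increasing; lra.
- intros eps He. rewrite <- (exp_ln r Hr) at 1.
  assert (H : - (PI * eps) <= ln r).
  { apply Rmult_le_compat_l with (r := PI) in He; [| lra].
    replace (PI * (- ln r / PI)) with (- ln r) in He by (field; lra). lra. }
  destruct H as [H | ->]; [apply Rlt_le, exp_increasing, H | lra].
Qed.

(** * Growth of a cocycle whose constant term is a scalar matrix *)

Section TwoStep.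
Variables (B : R -> R -> M2) (a : R) (tau : CC).
Hypotheses (R11 : Rep 1 (fun e x => m11 (B e x)) tau) (R12 : Rep 1 (fun e x => m12 (B e x)) C0)
  (R21 : Rep 1 (fun e x => m21 (B e x)) C0) (R22 : Rep 1 (fun e x => m22 (B e x)) tau).
Hypothesis Htau : 0 < Cmod tau.
Hypothesis Hirr : forall m, Cpow (cis (PI * IZR 1 * a)) (S m) <> C1.

(** The order of quantifiers matters: [e0] is fixed before [theta], so at a given [eps] one may let
    [theta] tend to [1] and bound the rate by exactly [|tau|]. *)
Lemma cocycle_subexponential :
  exists e0, 0 <= e0 /\ forall theta, 0 < theta < 1 ->
  exists C, 0 < C /\ forall eps, e0 <= eps -> forall n x,
    msum (cocycle (B eps) a n x) <= C * / (theta / Cmod tau) ^ n.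
Proof.
destruct R11 as [d11 [p11 [D11 [I11 E11]]]]. destruct R12 as [d12 [p12 [D12 [I12 E12]]]].
destruct R21 as [d21 [p21 [D21 [I21 E21]]]]. destruct R22 as [d22 [p22 [D22 [I22 E22]]]].
set (d := (d11 + d12 + d21 + d22)%nat).
assert (U : forall di p, deg_le p di -> (di <= d)%nat -> forall u, pev di p u = pev d p u).
{ intros. symmetry. now apply pev_deg. }
assert (D11' := deg_le_mono _ _ d D11 ltac:(unfold d; lia)).
assert (D12' := deg_le_mono _ _ d D12 ltac:(unfold d; lia)).
assert (D21' := deg_le_mono _ _ d D21 ltac:(unfold d; lia)).
assert (D22' := deg_le_mono _ _ d D22 ltac:(unfold d; lia)).
assert (E11' : forall e x, m11 (B e x) = pev d p11 (em 1 e x))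
  by (intros; rewrite E11; apply U; [auto | unfold d; lia]).
assert (E12' : forall e x, m12 (B e x) = pev d p12 (em 1 e x))
  by (intros; rewrite E12; apply U; [auto | unfold d; lia]).
assert (E21' : forall e x, m21 (B e x) = pev d p21 (em 1 e x))
  by (intros; rewrite E21; apply U; [auto | unfold d; lia]).
assert (E22' : forall e x, m22 (B e x) = pev d p22 (em 1 e x))
  by (intros; rewrite E22; apply U; [auto | unfold d; lia]).
clear E11 E12 E21 E22.
destruct (deg_le_bounded d p11 D11') as [b11 H11]. destruct (deg_le_bounded d p12 D12') as [b12 H12].
destruct (deg_le_bounded d p21 D21') as [b21 H21]. destruct (deg_le_bounded d p22 D22') as [b22 H22].
set (beta := Rmax (Rmax b11 b12) (Rmax b21 b22)).
assert (P11 : forall i, Cmod (p11 i) <= beta).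
{ intros i. eapply Rle_trans; [apply H11 |]. unfold beta.
  eapply Rle_trans; [apply (Rmax_l b11 b12) | apply Rmax_l]. }
assert (P12 : forall i, Cmod (p12 i) <= beta).
{ intros i. eapply Rle_trans; [apply H12 |]. unfold beta.
  eapply Rle_trans; [apply (Rmax_r b11 b12) | apply Rmax_l]. }
assert (P21 : forall i, Cmod (p21 i) <= beta).
{ intros i. eapply Rle_trans; [apply H21 |]. unfold beta.
  eapply Rle_trans; [apply (Rmax_l b21 b22) | apply Rmax_r]. }
assert (P22 : forall i, Cmod (p22 i) <= beta).
{ intros i. eapply Rle_trans; [apply H22 |]. unfold beta.
  eapply Rle_trans; [apply (Rmax_r b21 b22) | apply Rmax_r]. }
assert (Hbeta : 0 <= beta) by (eapply Rle_trans; [apply Cmod_ge_0 | apply (P11 O)]).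
set (zeta := cis (PI * IZR 1 * a)) in *.
assert (Hzeta : Cmod zeta = 1) by apply Cmod_cis.
set (r := rows zeta p11 p12 p21 p22).
assert (Hdeg : forall c c' n, deg_le (fst (r (cst c) (cst c') n)) (n * d) /\
                              deg_le (snd (r (cst c) (cst c') n)) (n * d)).
{ intros c c'. induction n as [| n [IH1 IH2]].
  - split; intros [| k] Hk; (lia || reflexivity).
  - split; intros k Hk; simpl; fold r;
      rewrite (deg_le_conv (n * d) (twist zeta (fst (r (cst c) (cst c') n)))) with (e := d),
              (deg_le_conv (n * d) (twist zeta (snd (r (cst c) (cst c') n)))) with (e := d);
      try apply deg_le_twist; auto; try lia; ring. }
(* An arbitrary combination of the two rows is followed at once; the weights [(C1, C0)] and
   [(C0, C1)] recover the rows themselves. *)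
assert (Hev : forall e c c' n x,
   Cadd (Cmul c (m11 (cocycle (B e) a n x))) (Cmul c' (m21 (cocycle (B e) a n x)))
     = pev (n * d) (fst (r (cst c) (cst c') n)) (em 1 e x) /\
   Cadd (Cmul c (m12 (cocycle (B e) a n x))) (Cmul c' (m22 (cocycle (B e) a n x)))
     = pev (n * d) (snd (r (cst c) (cst c') n)) (em 1 e x)).
{ intros e c c'. induction n; intros x; [split; simpl; ring |].
  rewrite cocycle_right. unfold M2mul; cbn [m11 m12 m21 m22].
  rewrite (E11' e x), (E12' e x), (E21' e x), (E22' e x).
  destruct (IHn (x + a)) as [IH1 IH2]. rewrite em_shift in IH1, IH2. fold zeta in IH1, IH2.
  rewrite <- pev_twist in IH1, IH2. destruct (Hdeg c c' n) as [G1 G2].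
  apply (deg_le_twist zeta) in G1. apply (deg_le_twist zeta) in G2.
  set (f := fst (r (cst c) (cst c') n)) in *. set (g := snd (r (cst c) (cst c') n)) in *.
  change (fst (r (cst c) (cst c') (S n)))
    with (fun k => Cadd (conv k (twist zeta f) p11) (conv k (twist zeta g) p21)).
  change (snd (r (cst c) (cst c') (S n)))
    with (fun k => Cadd (conv k (twist zeta f) p12) (conv k (twist zeta g) p22)).
  replace (S n * d)%nat with (n * d + d)%nat by lia.
  rewrite !pev_add, !pev_conv by auto. rewrite <- IH1, <- IH2. split; ring. }
(* [Q] meets both lower bounds of [rows_bound]; the threshold [/ (8 * Q)] for [|u|] then gives
   [4 * Q * |u| <= 1 / 2]. *)
set (Q := 4 + 4 * beta / Cmod tau).
assert (HQ4 : 0 <= 4 * beta / Cmod tau) by (apply Rmult_le_pos; [lra | apply Rlt_le, Rinv_0_lt_compat, Htau]).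
assert (HQ : 4 <= Q) by (unfold Q; lra).
assert (HQb : 4 * beta <= Q * Cmod tau).
{ unfold Q. replace ((4 + 4 * beta / Cmod tau) * Cmod tau) with (4 * Cmod tau + 4 * beta) by (field; lra).
  lra. }
assert (HQi : 0 < / (8 * Q)) by (apply Rinv_0_lt_compat; lra).
assert (HQi1 : / (8 * Q) <= 1) by (rewrite <- Rinv_1; apply Rinv_le_contravar; lra).
destruct (exp_small_of_large (/ (8 * Q)) HQi HQi1) as [e0 [He0 Hsmall]].
exists e0. split; [exact He0 |]. intros theta Hth.
assert (Hrow : forall c c', Cmod c <= 1 -> Cmod c' <= 1 ->
  exists C, 0 < C /\ forall n k,
   Cmod (fst (r (cst c) (cst c') n) k) <= C * / (theta / Cmod tau) ^ n * (4 * Q) ^ k /\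
   Cmod (snd (r (cst c) (cst c') n) k) <= C * / (theta / Cmod tau) ^ n * (4 * Q) ^ k).
{ intros c c' Hc Hc'.
  apply (rows_bound tau zeta beta p11 p12 p21 p22
    (fun n => fst (r (cst c) (cst c') n)) (fun n => snd (r (cst c) (cst c') n))); auto.
  intros n k. split; reflexivity. }
destruct (Hrow C1 C0) as [K1 [HK1 B1]]; [rewrite Cmod_C1; lra | rewrite Cmod_C0; lra |].
destruct (Hrow C0 C1) as [K2 [HK2 B2]]; [rewrite Cmod_C0; lra | rewrite Cmod_C1; lra |].
(* Two entries per row, each bounded by twice the constant of its row. *)
exists (4 * K1 + 4 * K2). split; [lra |]. intros eps Heps n x.
specialize (Hsmall eps Heps).
assert (Hu : 4 * Q * Cmod (em 1 eps x) <= / 2).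
{ rewrite Cmod_em, Rmult_1_r.
  apply Rle_trans with (4 * Q * / (8 * Q)); [apply Rmult_le_compat_l; lra |].
  right. field. lra. }
set (W := / (theta / Cmod tau) ^ n) in *.
assert (HW : 0 < W) by (apply Rinv_0_lt_compat, pow_lt, Rdiv_lt_0_compat; lra).
assert (HPE : forall K f, 0 < K -> (forall k, Cmod (f k) <= K * W * (4 * Q) ^ k) ->
   Cmod (pev (n * d) f (em 1 eps x)) <= 2 * (K * W)).
{ intros K f HK Hf. apply pev_bound with (q := 4 * Q); auto; [nra | lra]. }
destruct (Hev eps C1 C0 n x) as [V11 V12]. destruct (Hev eps C0 C1 n x) as [V21 V22].
assert (X11 := HPE K1 _ HK1 (fun k => proj1 (B1 n k))).
assert (X12 := HPE K1 _ HK1 (fun k => proj2 (B1 n k))).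
assert (X21 := HPE K2 _ HK2 (fun k => proj1 (B2 n k))).
assert (X22 := HPE K2 _ HK2 (fun k => proj2 (B2 n k))).
rewrite <- V11 in X11. rewrite <- V12 in X12. rewrite <- V21 in X21. rewrite <- V22 in X22.
unfold msum. set (M := cocycle (B eps) a n x) in *.
replace (Cadd (Cmul C1 (m11 M)) (Cmul C0 (m21 M))) with (m11 M) in X11 by ring.
replace (Cadd (Cmul C1 (m12 M)) (Cmul C0 (m22 M))) with (m12 M) in X12 by ring.
replace (Cadd (Cmul C0 (m11 M)) (Cmul C1 (m21 M))) with (m21 M) in X21 by ring.
replace (Cadd (Cmul C0 (m12 M)) (Cmul C1 (m22 M))) with (m22 M) in X22 by ring.
lra.
Qed.
End TwoStep.

Lemma cis_eq_1 y : cis y = C1 -> exists k : Z, y = 2 * PI * IZR k.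
Proof.
intros H. assert (Hc : cos y = 1) by exact (f_equal fst H).
(* The half-angle formula reduces the claim to the zeros of the sine. *)
replace y with (2 * (y / 2)) in Hc by field. rewrite cos_2a_sin in Hc.
assert (Hs : sin (y / 2) = 0) by nra.
destruct (sin_eq_0_0 _ Hs) as [k Hk]. exists k. lra.
Qed.

(** [em 1] has frequency [1 / 2] and the two-step cocycle rotates by [2 * alpha], so the multiplier
    is [exp (2 i pi alpha)]. *)
Lemma irrational_rotation alpha : irrational alpha ->
  forall m, Cpow (cis (PI * IZR 1 * (2 * alpha))) (S m) <> C1.
Proof.
intros H m E. rewrite cis_pow in E. destruct (cis_eq_1 _ E) as [k Hk].
apply (H k (Z.of_nat (S m))); [lia |].
rewrite <- INR_IZR_INZ. assert (HS : INR (S m) <> 0) by (apply not_0_INR; lia).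
assert (HP := PI_RGT_0). apply Rmult_eq_reg_r with (INR (S m)); [| exact HS].
unfold Rdiv. rewrite Rmult_assoc, Rinv_l, Rmult_1_r by exact HS.
apply Rmult_eq_reg_l with (2 * PI); lra.
Qed.

Lemma M2mul_scal a b A B : M2mul (M2scal a A) (M2scal b B) = M2scal (Cmul a b) (M2mul A B).
Proof. unfold M2mul, M2scal; simpl. f_equal; ring. Qed.

Lemma M2scal_1 A : M2scal C1 A = A.
Proof. destruct A. unfold M2scal; simpl. f_equal; ring. Qed.

(** * Gauge transformation of the Jacobi cocycle, its determinant and its growth *)

Section Jacobi.
Variables (alpha : R) (M : nat) (lam : Z -> CC) (N1 N2 : Z) (mu : Z -> CC) (E : R).
Hypothesis HN : (N1 < N2)%Z.
Hypothesis Hgap : (N2 - N1 > 2 * Z.of_nat M)%Z.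

Let A eps := AJ M lam N1 N2 mu alpha E eps.
(** [kap'] is the phase produced by translating the gauge by [alpha]; [kap] cancels it in the first
    row of [gauged]. *)
Let kap := cis (PI * IZR (N1 + N2) * alpha).
Let kap' := cis (- (PI * IZR (N1 + N2) * alpha)).

(* [A] conjugated by [diag (em (- (N1 + N2))) 1] and rescaled, so that it becomes a
   polynomial in [em 1] whose constant term is antidiagonal *)
Definition gauged (eps x : R) : M2 :=
  mkM2 (Cmul kap (Cmul (em (N2 - N1) eps x) (m11 (A eps x))))
       (Cmul kap (Cmul (em (2 * N2) eps x) (m12 (A eps x))))
       (Cmul (em (2 * - N1) eps x) (m21 (A eps x)))
       C0.

Definition gauge (eps x : R) : M2 := mkM2 (em (- (N1 + N2)) eps x) C0 C0 C1.
Definition gauge_inv (eps x : R) : M2 := mkM2 (em (N1 + N2) eps x) C0 C0 C1.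

Lemma kap_kap' : Cmul kap' kap = C1.
Proof. unfold kap, kap'. rewrite <- cis_add, Rplus_opp_l. apply cis_0. Qed.

Lemma gauge_gauge_inv eps x : M2mul (gauge_inv eps x) (gauge eps x) = M2id.
Proof.
unfold M2mul, gauge, gauge_inv, M2id; cbn [m11 m12 m21 m22].
rewrite <- em_add, Z.add_opp_diag_r, em_0. f_equal; ring.
Qed.

Lemma AJ_gauged eps x :
  A eps x = M2scal (em (- (N2 - N1)) eps x)
    (M2mul (gauge eps (x + alpha)) (M2mul (gauged eps x) (gauge_inv eps x))).
Proof.
assert (Es : em (- (N1 + N2)) eps (x + alpha) = Cmul kap' (em (- (N1 + N2)) eps x)).
{ rewrite em_shift. unfold kap'. rewrite opp_IZR. do 2 f_equal. ring. }
assert (F1 : Cmul (em (- (N2 - N1)) eps x) (em (N2 - N1) eps x) = C1).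
{ rewrite <- em_add, Z.add_opp_diag_l. apply em_0. }
assert (F2 : Cmul (em (- (N1 + N2)) eps x) (em (N1 + N2) eps x) = C1).
{ rewrite <- em_add, Z.add_opp_diag_l. apply em_0. }
assert (F3 : Cmul (em (- (N2 - N1)) eps x) (Cmul (em (- (N1 + N2)) eps x) (em (2 * N2) eps x)) = C1).
{ rewrite <- !em_add. replace (- (N2 - N1) + (- (N1 + N2) + 2 * N2))%Z with 0%Z by ring. apply em_0. }
assert (F4 : Cmul (em (- (N2 - N1)) eps x) (Cmul (em (2 * - N1) eps x) (em (N1 + N2) eps x)) = C1).
{ rewrite <- !em_add. replace (- (N2 - N1) + (2 * - N1 + (N1 + N2)))%Z with 0%Z by ring. apply em_0. }
unfold M2scal, M2mul, gauge, gauge_inv, gauged; cbn [m11 m12 m21 m22]. rewrite Es.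
change (A eps x) with (mkM2 (m11 (A eps x)) (m12 (A eps x)) (m21 (A eps x)) C0) at 1.
assert (K := kap_kap').
f_equal.
- set (w := m11 (A eps x)).
  transitivity (Cmul (Cmul (Cmul (em (- (N2 - N1)) eps x) (em (N2 - N1) eps x))
    (Cmul (em (- (N1 + N2)) eps x) (em (N1 + N2) eps x))) (Cmul (Cmul kap' kap) w)); [| ring].
  rewrite F1, F2, K. ring.
- set (w := m12 (A eps x)).
  transitivity (Cmul (Cmul (em (- (N2 - N1)) eps x) (Cmul (em (- (N1 + N2)) eps x) (em (2 * N2) eps x)))
     (Cmul (Cmul kap' kap) w)); [| ring].
  rewrite F3, K. ring.
- set (w := m21 (A eps x)).
  transitivity (Cmul (Cmul (em (- (N2 - N1)) eps x) (Cmul (em (2 * - N1) eps x) (em (N1 + N2) eps x)))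
     w); [| ring].
  rewrite F4. ring.
- ring.
Qed.

(** Consecutive gauges telescope, each meeting its inverse in the next factor. The scalar [g] has
    modulus independent of [x] and carries the growth [pi (N2 - N1) eps] per step. *)
Lemma cocycle_gauged eps n x :
  exists g, Cmod g = exp (PI * IZR (N2 - N1) * eps) ^ n /\
  cocycle (A eps) alpha n x = M2scal g (M2mul (gauge eps (x + INR n * alpha))
    (M2mul (cocycle (gauged eps) alpha n x) (gauge_inv eps x))).
Proof.
induction n as [| n [g [Hg IH]]].
- exists C1. split; [apply Cmod_C1 |].
  simpl. rewrite Rmult_0_l, Rplus_0_r, M2mul_id_l, M2scal_1.
  unfold M2mul, gauge, gauge_inv, M2id; cbn [m11 m12 m21 m22].
  rewrite <- em_add, Z.add_opp_diag_l, em_0. f_equal; ring.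
- exists (Cmul (em (- (N2 - N1)) eps (x + INR n * alpha)) g). split.
  + rewrite Cmod_mul, Hg, Cmod_em, opp_IZR. simpl. f_equal. f_equal. ring.
  + change (cocycle (A eps) alpha (S n) x)
      with (M2mul (A eps (x + INR n * alpha)) (cocycle (A eps) alpha n x)).
    rewrite IH, AJ_gauged, M2mul_scal. f_equal.
    change (cocycle (gauged eps) alpha (S n) x)
      with (M2mul (gauged eps (x + INR n * alpha)) (cocycle (gauged eps) alpha n x)).
    replace (x + INR (S n) * alpha) with (x + INR n * alpha + alpha) by (rewrite S_INR; ring).
    rewrite <- !M2mul_assoc. f_equal. f_equal. rewrite M2mul_assoc, gauge_gauge_inv, M2mul_id_l.
    reflexivity.
Qed.

(** Constant coefficient of the upper right entry of [gauged], contributed by the index [N2] of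
    [ctilde]. *)
Definition c12 : CC :=
  Cmul (Copp kap) (Cmul (Cconj (mu N2)) (cis (PI * IZR (2 * - N2) * (- alpha)))).

Lemma Cmod_c12 : Cmod c12 = Cmod (mu N2).
Proof.
unfold c12, kap. rewrite !Cmod_mul, Cmod_opp, !Cmod_cis, Cmod_conj. ring.
Qed.

(** The index [k] lands in degree [t * (k - N1)], so [N1] alone gives the constant term. The pair
    [(h, t)] is [(1, 2)] in the growth estimate and [(2, 1)] for the determinant, where period [1]
    in [x] is wanted. *)
Lemma gauged21_Rep h t : (h * t = 2)%Z -> (0 < t)%Z -> Rep h (fun eps x => m21 (gauged eps x)) (mu N1).
Proof.
intros Hht Ht.
replace (mu N1) with (Csum (zrange N1 N2) (fun k => if Z.eqb (t * (k - N1)) 0 then mu k else C0)).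
- apply Rep_ext with (fun eps x => Csum (zrange N1 N2)
    (fun k => Cmul (mu k) (em (h * (t * (k - N1))) eps x))).
  + intros. unfold gauged, A, AJ. cbn [m21]. unfold cfun. rewrite Csum_mul. apply Csum_ext. intros k _.
    rewrite efun_em.
    replace (h * (t * (k - N1)))%Z with (2 * - N1 + 2 * k)%Z by (rewrite Z.mul_assoc, Hht; ring).
    rewrite em_add. ring.
  + apply (Rep_Csum h (zrange N1 N2) (fun k eps x => Cmul (mu k) (em (h * (t * (k - N1))) eps x))).
    intros k Hk. apply In_zrange in Hk. apply Rep_monomial. nia.
- rewrite (Csum_single _ N1); [| apply NoDup_zrange | apply In_zrange; lia |].
  + replace (t * (N1 - N1))%Z with 0%Z by ring. reflexivity.
  + intros k _ Hk. replace (Z.eqb (t * (k - N1)) 0) with false; [reflexivity |].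
    symmetry. apply Z.eqb_neq. nia.
Qed.

(** The frequencies of [ctilde] are reversed, so the degrees are [t * (N2 - k)] and the constant
    term comes from [N2]. *)
Lemma gauged12_Rep h t : (h * t = 2)%Z -> (0 < t)%Z -> Rep h (fun eps x => m12 (gauged eps x)) c12.
Proof.
intros Hht Ht.
set (b := fun k => Cmul (Copp kap) (Cmul (Cconj (mu k)) (cis (PI * IZR (2 * - k) * (- alpha))))).
replace c12 with (Csum (zrange N1 N2) (fun k => if Z.eqb (t * (N2 - k)) 0 then b k else C0)).
- apply Rep_ext with (fun eps x => Csum (zrange N1 N2)
    (fun k => Cmul (b k) (em (h * (t * (N2 - k))) eps x))).
  + intros. unfold gauged, A, AJ. cbn [m12]. unfold ctilde.
    transitivity (Cmul (Cmul (Copp kap) (em (2 * N2) eps x))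
      (Csum (zrange N1 N2) (fun k => Cmul (Cconj (mu k)) (efun (- k) (x - alpha, eps)))));
      [| ring].
    rewrite Csum_mul. apply Csum_ext. intros k _.
    rewrite efun_em. unfold Rminus. rewrite em_shift.
    replace (h * (t * (N2 - k)))%Z with (2 * N2 + 2 * - k)%Z by (rewrite Z.mul_assoc, Hht; ring).
    rewrite em_add. unfold b. ring.
  + apply (Rep_Csum h (zrange N1 N2) (fun k eps x => Cmul (b k) (em (h * (t * (N2 - k))) eps x))).
    intros k Hk. apply In_zrange in Hk. apply Rep_monomial. nia.
- rewrite (Csum_single _ N2); [| apply NoDup_zrange | apply In_zrange; lia |].
  + replace (t * (N2 - N2))%Z with 0%Z by ring. reflexivity.
  + intros k _ Hk. replace (Z.eqb (t * (N2 - k)) 0) with false; [reflexivity |].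
    symmetry. apply Z.eqb_neq. nia.
Qed.

(* this is where [2 M < N2 - N1] is used *)
Lemma gauged11_Rep : Rep 1 (fun eps x => m11 (gauged eps x)) C0.
Proof.
set (l := List.filter (fun j => negb (Z.eqb j 0)) (zrange (- Z.of_nat M) (Z.of_nat M))).
apply Rep_ext with (fun eps x => Cadd
  (Cmul (Cmul kap (RtoC E)) (em (1 * (N2 - N1)) eps x))
  (Cmul (Copp kap) (Csum l (fun j => Cmul (lam j) (em (1 * (N2 - N1 + 2 * j)) eps x))))).
- intros. unfold gauged, A, AJ. cbn [m11]. unfold vpot. fold l. rewrite Z.mul_1_l.
  assert (H : Csum l (fun j => Cmul (lam j) (em (1 * (N2 - N1 + 2 * j)) eps x)) =
     Cmul (em (N2 - N1) eps x) (Csum l (fun j => Cmul (lam j) (efun j (x, eps))))).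
  { rewrite Csum_mul. apply Csum_ext. intros j _. rewrite efun_em, Z.mul_1_l, em_add. ring. }
  rewrite H. ring.
- replace C0 with (Cadd (Cmul (Cmul kap (RtoC E)) C0) (Cmul (Copp kap) (Csum l (fun j => Cmul (lam j) C0)))) at 1.
  + apply Rep_add.
    * apply Rep_mul; [apply Rep_const | apply Rep_em; lia].
    * apply Rep_mul; [apply Rep_const |].
      apply (Rep_Csum 1 l (fun j eps x => Cmul (lam j) (em (1 * (N2 - N1 + 2 * j)) eps x))).
      intros j Hj. apply filter_In in Hj. destruct Hj as [Hj _]. apply In_zrange in Hj.
      apply Rep_mul; [apply Rep_const | apply Rep_em; lia].
  + rewrite (Csum_ext l _ (fun _ => C0)), Csum_C0 by (intros; ring). ring.
Qed.

Lemma gauged22_Rep : Rep 1 (fun eps x => m22 (gauged eps x)) C0.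
Proof. apply (Rep_const 1 C0). Qed.

Lemma det_cocycle_Rep n : exists q, Rep 2 q (Cpow (Cmul c12 (mu N1)) n) /\
  forall eps x, Cmod (M2det (cocycle (A eps) alpha n x))
    = exp (2 * PI * IZR (N2 - N1) * eps) ^ n * Cmod (q eps x).
Proof.
induction n as [| n [q [Hq IH]]].
- exists (fun _ _ => C1). split; [apply Rep_const |]. intros.
  replace (M2det (cocycle (A eps) alpha 0 x)) with C1 by (unfold M2det; simpl; ring).
  simpl. ring.
- exists (fun eps x => Cmul (Cmul (m12 (gauged eps (x + INR n * alpha)))
                                  (m21 (gauged eps (x + INR n * alpha)))) (q eps x)). split.
  + simpl. apply Rep_mul; [| exact Hq].
    apply (Rep_shift 2 (fun eps x => Cmul (m12 (gauged eps x)) (m21 (gauged eps x)))).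
    apply Rep_mul; [apply (gauged12_Rep 2 1) | apply (gauged21_Rep 2 1)]; lia.
  + intros. change (cocycle (A eps) alpha (S n) x)
      with (M2mul (A eps (x + INR n * alpha)) (cocycle (A eps) alpha n x)).
    rewrite M2det_mul, !Cmod_mul, IH. simpl pow.
    set (y := x + INR n * alpha).
    assert (Hdet : Cmod (M2det (A eps y)) = exp (2 * PI * IZR (N2 - N1) * eps)
       * (Cmod (m12 (gauged eps y)) * Cmod (m21 (gauged eps y)))); [| rewrite Hdet; ring].
    unfold M2det, gauged. cbn [m12 m21]. rewrite !Cmod_mul, !Cmod_em. unfold kap. rewrite Cmod_cis.
    set (b := m12 (A eps y)). set (c := m21 (A eps y)).
    replace (Csub (Cmul (m11 (A eps y)) (m22 (A eps y))) (Cmul b c)) with (Copp (Cmul b c))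
      by (unfold A at 1 2, AJ; cbn [m11 m22]; ring).
    rewrite Cmod_opp, Cmod_mul.
    assert (He : exp (2 * PI * IZR (N2 - N1) * eps) * (exp (- (PI * IZR (2 * N2) * eps))
       * exp (- (PI * IZR (2 * - N1) * eps))) = 1).
    { rewrite <- !exp_plus, <- exp_0. f_equal. rewrite !mult_IZR, opp_IZR, minus_IZR. ring. }
    transitivity (exp (2 * PI * IZR (N2 - N1) * eps) * (exp (- (PI * IZR (2 * N2) * eps))
       * exp (- (PI * IZR (2 * - N1) * eps))) * (Cmod b * Cmod c)); [rewrite He |]; ring.
Qed.

Hypothesis Halpha : irrational alpha.
Hypotheses (Hmu1 : mu N1 <> C0) (Hmu2 : mu N2 <> C0).

(** Returning from two steps to one and undoing the gauge changes only the constant, apart from the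
    scalar of [cocycle_gauged], which supplies the term linear in [eps]. The threshold again
    precedes [delta]. *)
Lemma cocycle_upper : exists e0, 0 <= e0 /\ forall eps, e0 <= eps -> forall delta, 0 < delta ->
  exists C, 0 < C /\ forall n x, M2norm (cocycle (A eps) alpha n x) <=
    C * exp (INR n * (PI * IZR (N2 - N1) * eps + / 2 * (ln (Cmod (mu N1)) + ln (Cmod (mu N2))) + delta)).
Proof.
(* The constant term of one step is antidiagonal; that of two steps is the scalar [c12 * mu N1]. *)
set (B2 := fun eps y => M2mul (gauged eps (y + alpha)) (gauged eps y)).
set (tau := Cmul c12 (mu N1)).
assert (R12 := gauged12_Rep 1 2 eq_refl eq_refl). assert (R21 := gauged21_Rep 1 2 eq_refl eq_refl).
assert (R11 := gauged11_Rep). assert (R22 := gauged22_Rep).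
assert (R11' := Rep_shift _ _ _ alpha R11). assert (R12' := Rep_shift _ _ _ alpha R12).
assert (R21' := Rep_shift _ _ _ alpha R21). assert (R22' := Rep_shift _ _ _ alpha R22).
assert (T11 : Rep 1 (fun e x => m11 (B2 e x)) tau).
{ replace tau with (Cadd (Cmul C0 C0) (Cmul c12 (mu N1))) by (unfold tau; ring).
  apply (Rep_add 1 _ _ _ _ (Rep_mul _ _ _ _ _ R11' R11) (Rep_mul _ _ _ _ _ R12' R21)). }
assert (T12 : Rep 1 (fun e x => m12 (B2 e x)) C0).
{ replace C0 with (Cadd (Cmul C0 c12) (Cmul c12 C0)) at 1 by ring.
  apply (Rep_add 1 _ _ _ _ (Rep_mul _ _ _ _ _ R11' R12) (Rep_mul _ _ _ _ _ R12' R22)). }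
assert (T21 : Rep 1 (fun e x => m21 (B2 e x)) C0).
{ replace C0 with (Cadd (Cmul (mu N1) C0) (Cmul C0 (mu N1))) at 1 by ring.
  apply (Rep_add 1 _ _ _ _ (Rep_mul _ _ _ _ _ R21' R11) (Rep_mul _ _ _ _ _ R22' R21)). }
assert (T22 : Rep 1 (fun e x => m22 (B2 e x)) tau).
{ replace tau with (Cadd (Cmul (mu N1) c12) (Cmul C0 C0)) by (unfold tau; ring).
  apply (Rep_add 1 _ _ _ _ (Rep_mul _ _ _ _ _ R21' R12) (Rep_mul _ _ _ _ _ R22' R22)). }
assert (HT : Cmod tau = Cmod (mu N1) * Cmod (mu N2)).
{ unfold tau. rewrite Cmod_mul, Cmod_c12. ring. }
assert (Hp1 := Cmod_pos _ Hmu1). assert (Hp2 := Cmod_pos _ Hmu2).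
assert (HTp : 0 < Cmod tau) by (rewrite HT; now apply Rmult_lt_0_compat).
destruct (cocycle_subexponential B2 (2 * alpha) tau T11 T12 T21 T22 HTp
  (irrational_rotation alpha Halpha)) as [e1 [He1 HS]].
destruct (exp_small_of_large (/ 2) ltac:(lra) ltac:(lra)) as [e2 [He2 Hsm]].
destruct (Rep_bounded _ _ R11) as [b11 Hb11]. destruct (Rep_bounded _ _ R12) as [b12 Hb12].
destruct (Rep_bounded _ _ R21) as [b21 Hb21]. destruct (Rep_bounded _ _ R22) as [b22 Hb22].
exists (Rmax e1 e2). split; [eapply Rle_trans; [exact He1 | apply Rmax_l] |].
intros eps Heps delta Hdelta.
assert (Heps1 : e1 <= eps) by (eapply Rle_trans; [apply Rmax_l | exact Heps]).
assert (Heps2 : e2 <= eps) by (eapply Rle_trans; [apply Rmax_r | exact Heps]).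
set (lt := / 2 * (ln (Cmod (mu N1)) + ln (Cmod (mu N2)))).
(* Taking [theta = exp (-2 delta)] for a double step amounts to a loss of [delta] per single
   step. *)
assert (Hth : 0 < exp (- (2 * delta)) < 1).
{ split; [apply exp_pos |]. rewrite <- exp_0. apply exp_increasing. lra. }
destruct (HS _ Hth) as [C [HC HS']]. specialize (HS' eps Heps1).
assert (HTe : forall n, / (exp (- (2 * delta)) / Cmod tau) ^ n = exp (INR (2 * n) * (lt + delta))).
{ assert (HTl : Cmod tau = exp (2 * lt)).
  { unfold lt. rewrite HT, <- (exp_ln _ Hp1), <- (exp_ln _ Hp2), <- exp_plus, !ln_exp. f_equal. field. }
  intros n. rewrite HTl. unfold Rdiv. rewrite <- exp_Ropp, <- exp_plus.
  rewrite <- Rpower_pow by apply exp_pos. unfold Rpower. rewrite ln_exp, <- exp_Ropp. f_equal.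
  rewrite mult_INR. simpl (INR 2). ring. }
set (b := b11 + b12 + b21 + b22).
assert (Hb : forall x, msum (gauged eps x) <= b).
{ intros x. unfold msum, b. specialize (Hsm eps Heps2).
  specialize (Hb11 eps x Hsm). specialize (Hb12 eps x Hsm).
  specialize (Hb21 eps x Hsm). specialize (Hb22 eps x Hsm). lra. }
assert (Hb0 : 0 <= b) by (eapply Rle_trans; [apply msum_ge_0 | apply (Hb 0)]).
(* The second summand pays for the extra factor when the number of steps is odd. *)
set (C' := C * (1 + b * exp (- (lt + delta)))).
assert (HC' : 0 < C').
{ apply Rmult_lt_0_compat; [exact HC |]. assert (H := exp_pos (- (lt + delta))). nra. }
assert (HB : forall n x, msum (cocycle (gauged eps) alpha n x) <= C' * exp (INR n * (lt + delta))).
{ intros n x. assert (Hev : forall m y, msum (cocycle (gauged eps) alpha (2 * m) y)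
      <= C * exp (INR (2 * m) * (lt + delta))).
  { intros m y. rewrite cocycle_double, <- HTe. apply HS'. }
  assert (Hcc : C * 1 <= C').
  { apply Rmult_le_compat_l; [lra |]. assert (H := exp_pos (- (lt + delta))). nra. }
  destruct (Nat.Even_or_Odd n) as [[m ->] | [m ->]].
  - eapply Rle_trans; [apply Hev |]. apply Rmult_le_compat_r; [apply Rlt_le, exp_pos | lra].
  - rewrite Nat.add_1_r.
    change (cocycle (gauged eps) alpha (S (2 * m)) x)
      with (M2mul (gauged eps (x + INR (2 * m) * alpha)) (cocycle (gauged eps) alpha (2 * m) x)).
    eapply Rle_trans; [apply msum_mul |].
    apply Rle_trans with (b * (C * exp (INR (2 * m) * (lt + delta)))).
    + apply Rmult_le_compat; auto using msum_ge_0.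
    + replace (exp (INR (2 * m) * (lt + delta)))
        with (exp (- (lt + delta)) * exp (INR (S (2 * m)) * (lt + delta)))
        by (rewrite <- exp_plus; f_equal; rewrite S_INR; ring).
      assert (H := exp_pos (INR (S (2 * m)) * (lt + delta))). unfold C'. nra. }
(* Product of the [msum] norms of the gauge and of its inverse, which depend on neither [x] nor
   [n]. *)
set (G := (exp (- (PI * IZR (- (N1 + N2)) * eps)) + 1) * (exp (- (PI * IZR (N1 + N2) * eps)) + 1)).
assert (HG : 0 < G).
{ apply Rmult_lt_0_compat; apply Rplus_lt_0_compat; try apply exp_pos; lra. }
exists (G * C'). split; [now apply Rmult_lt_0_compat |]. intros n x.
destruct (cocycle_gauged eps n x) as [g [Hg Hgn]].
eapply Rle_trans; [apply M2norm_le_msum |].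
rewrite Hgn, msum_scal, Hg.
assert (Hga : forall y, msum (gauge eps y) = exp (- (PI * IZR (- (N1 + N2)) * eps)) + 1).
{ intros. unfold msum, gauge; cbn [m11 m12 m21 m22]. rewrite Cmod_em, Cmod_C0, Cmod_C1. ring. }
assert (Hgi : forall y, msum (gauge_inv eps y) = exp (- (PI * IZR (N1 + N2) * eps)) + 1).
{ intros. unfold msum, gauge_inv; cbn [m11 m12 m21 m22]. rewrite Cmod_em, Cmod_C0, Cmod_C1. ring. }
rewrite <- Rpower_pow by apply exp_pos. unfold Rpower. rewrite ln_exp.
replace (INR n * (PI * IZR (N2 - N1) * eps + lt + delta))
  with (INR n * (PI * IZR (N2 - N1) * eps) + INR n * (lt + delta)) by ring.
rewrite exp_plus.
set (X := exp (INR n * (PI * IZR (N2 - N1) * eps))).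
assert (HX : 0 < X) by apply exp_pos.
apply Rle_trans with (X * (G * (C' * exp (INR n * (lt + delta))))); [| right; ring].
apply Rmult_le_compat_l; [lra |].
eapply Rle_trans; [apply msum_mul |]. rewrite Hga.
apply Rle_trans with ((exp (- (PI * IZR (- (N1 + N2)) * eps)) + 1) *
   ((C' * exp (INR n * (lt + delta))) * (exp (- (PI * IZR (N1 + N2) * eps)) + 1))); [| unfold G; right; ring].
apply Rmult_le_compat_l; [apply Rplus_le_le_0_compat; [apply Rlt_le, exp_pos | lra] |].
eapply Rle_trans; [apply msum_mul |]. rewrite Hgi.
apply Rmult_le_compat_r; [apply Rplus_le_le_0_compat; [apply Rlt_le, exp_pos | lra] |].
apply HB.
Qed.
End Jacobi.

(** * Jensen's inequality *)

Fixpoint csum (n : nat) (f : nat -> CC) : CC :=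
  match n with O => C0 | S m => Cadd (csum m f) (f m) end.

Lemma csum_ext n f g : (forall i, f i = g i) -> csum n f = csum n g.
Proof. intros H. induction n; simpl; [reflexivity | now rewrite IHn, H]. Qed.

Lemma csum_lin n a b f g :
  csum n (fun i => Cadd (Cmul a (f i)) (Cmul b (g i))) = Cadd (Cmul a (csum n f)) (Cmul b (csum n g)).
Proof. induction n; simpl; [ring | rewrite IHn; ring]. Qed.

Lemma csum_large n : forall f c, (0 < n)%nat -> INR n * c <= Cmod (csum n f) ->
  exists l, (l < n)%nat /\ c <= Cmod (f l).
Proof.
induction n; intros f c Hn H; [lia |].
destruct (Rle_lt_dec c (Cmod (f n))) as [h | h]; [exists n; split; [lia | exact h] |].
rewrite S_INR in H. simpl in H. assert (H1 := Cmod_add (csum n f) (f n)).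
destruct n as [| n].
- simpl in *. rewrite Cmod_C0 in H1. lra.
- destruct (IHn f c ltac:(lia)) as [l [Hl Hc]]; [lra |]. exists l. split; [lia | exact Hc].
Qed.

Lemma csum_root_of_unity L j : (0 < j < L)%nat ->
  csum L (fun l => Cpow (cis (2 * PI * INR l / INR L)) j) = C0.
Proof.
intros Hj. assert (HL : INR L <> 0) by (apply not_0_INR; lia).
set (w := cis (2 * PI * INR j / INR L)).
assert (E : forall l, Cpow (cis (2 * PI * INR l / INR L)) j = Cpow w l).
{ intros l. unfold w. rewrite !cis_pow. f_equal. field. exact HL. }
rewrite (csum_ext _ _ _ E).
assert (G : forall n, Cmul (Csub C1 w) (csum n (Cpow w)) = Csub C1 (Cpow w n)).
{ induction n; simpl; [ring |].
  transitivity (Cadd (Cmul (Csub C1 w) (csum n (Cpow w))) (Cmul (Csub C1 w) (Cpow w n))); [ring |].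
  rewrite IHn. ring. }
specialize (G L).
assert (HwL : Cpow w L = C1).
{ unfold w. rewrite cis_pow. replace (INR L * (2 * PI * INR j / INR L)) with (0 + 2 * INR j * PI) by (field; exact HL).
  unfold cis. rewrite cos_period, sin_period, cos_0, sin_0. reflexivity. }
rewrite HwL in G. replace (Csub C1 C1) with C0 in G by ring.
assert (G' := f_equal Cmod G). rewrite Cmod_mul, Cmod_C0 in G'.
apply Rmult_integral in G'. destruct G' as [G' | G']; [exfalso | now apply Cmod_eq_0].
(* If the ratio [w] were [1], then [L] would divide [j], against [0 < j < L]. *)
apply Cmod_eq_0 in G'. assert (Hw : w = C1) by (transitivity (Csub C1 (Csub C1 w)); [ring | rewrite G'; ring]).
destruct (cis_eq_1 _ Hw) as [k Hk]. assert (HP := PI_RGT_0).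
assert (Hk' : INR j = IZR k * INR L).
{ apply Rmult_eq_reg_l with (2 * PI); [| lra].
  replace (2 * PI * INR j) with (2 * PI * INR j / INR L * INR L) by (field; exact HL).
  rewrite Hk. ring. }
rewrite !INR_IZR_INZ, <- mult_IZR in Hk'. apply eq_IZR in Hk'.
assert (k <= 0 \/ 1 <= k)%Z as [h | h] by lia; nia.
Qed.

Lemma csum_const n c : csum n (fun _ => c) = Cmul (RtoC (INR n)) c.
Proof.
induction n; [simpl; change (RtoC 0) with C0; ring |].
rewrite RtoC_S. simpl csum. rewrite IHn. ring.
Qed.

(** Averaging over the [L]-th roots of unity kills the powers from [1] to [L - 1]. The extra power
    [j] lets the induction pass from [p] to its tail. *)
Lemma csum_pev L s : forall d p j, (j + d < L)%nat ->
  csum L (fun l => Cmul (Cpow (cis (2 * PI * INR l / INR L)) j)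
                        (pev d p (Cmul s (cis (2 * PI * INR l / INR L)))))
  = match j with O => Cmul (RtoC (INR L)) (p O) | S _ => C0 end.
Proof.
assert (Hpos : forall d p j, (0 < j)%nat -> (j + d < L)%nat ->
  csum L (fun l => Cmul (Cpow (cis (2 * PI * INR l / INR L)) j)
                        (pev d p (Cmul s (cis (2 * PI * INR l / INR L))))) = C0).
{ induction d; intros p j Hj H.
  - rewrite (csum_ext _ _ (fun l => Cadd (Cmul (p O) (Cpow (cis (2 * PI * INR l / INR L)) j)) (Cmul C0 C0)))
      by (intros; simpl; ring).
    rewrite (csum_lin L (p O) C0 _ (fun _ => C0)), csum_root_of_unity by lia. ring.
  - rewrite (csum_ext _ _ (fun l => Cadd (Cmul (p O) (Cpow (cis (2 * PI * INR l / INR L)) j))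
      (Cmul s (Cmul (Cpow (cis (2 * PI * INR l / INR L)) (S j))
         (pev d (tl p) (Cmul s (cis (2 * PI * INR l / INR L)))))))) by (intros; simpl; ring).
    rewrite csum_lin, csum_root_of_unity, IHd by lia. ring. }
intros d p [| j] H; [| apply Hpos; lia].
destruct d as [| d].
- rewrite (csum_ext _ _ (fun _ => p O)) by (intros; simpl; ring). apply csum_const.
- rewrite (csum_ext _ _ (fun l => Cadd (Cmul C1 (p O))
      (Cmul s (Cmul (Cpow (cis (2 * PI * INR l / INR L)) 1)
         (pev d (tl p) (Cmul s (cis (2 * PI * INR l / INR L)))))))) by (intros; simpl; ring).
  rewrite (csum_lin L C1 s (fun _ => p O)), csum_const, Hpos by lia. ring.
Qed.

Lemma em2_cis eps x : em 2 eps x = Cmul (RtoC (exp (- (PI * 2 * eps)))) (cis (2 * PI * x)).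
Proof. unfold em. do 2 f_equal. ring. Qed.

(** Discrete mean value property: over [d + 1] equally spaced nodes the average of [g] is its
    constant coefficient, so some node has at least that modulus. *)
Lemma Rep_max_modulus g c eps : Rep 2 g c -> exists t, 0 <= t <= 1 /\ Cmod c <= Cmod (g eps t).
Proof.
intros [d [p [_ [H2 H3]]]].
set (L := S d). assert (HL : 0 < INR L) by (apply lt_0_INR; unfold L; lia).
assert (E := csum_pev L (RtoC (exp (- (PI * 2 * eps)))) d p 0 ltac:(unfold L; lia)).
(* The chained equalities only rewrite the modulus of the sum as [INR L * Cmod (p O)]. *)
destruct (csum_large L _ (Cmod (p O)) ltac:(unfold L; lia) (Req_le _ _ (eq_sym (eq_trans (f_equal Cmod E)
   (eq_trans (Cmod_mul _ _) (f_equal (fun r => r * Cmod (p O)) (eq_trans (Cmod_RtoC _)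
     (Rabs_right _ (Rle_ge _ _ (pos_INR L)))))))))) as [l [Hl Hc]].
exists (INR l / INR L). split.
- split; [apply Rmult_le_pos; [apply pos_INR | apply Rlt_le, Rinv_0_lt_compat, HL] |].
  apply Rmult_le_reg_r with (INR L); [exact HL |]. unfold Rdiv.
  rewrite Rmult_assoc, Rinv_l, Rmult_1_r, Rmult_1_l by lra. apply le_INR. lia.
- rewrite H3, em2_cis, <- H2. simpl Cpow in Hc.
  replace (2 * PI * (INR l / INR L)) with (2 * PI * INR l / INR L) by (field; lra).
  rewrite Cmod_mul, Cmod_C1, Rmult_1_l in Hc. exact Hc.
Qed.

(** * Riemann sums and continuity of truncated logarithms *)

Lemma continuous_of_continuity_pt (f : R -> R) x : continuity_pt f x -> continuous f x.
Proof. intros H. now apply continuity_pt_filterlim. Qed.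

Lemma ex_RInt_continuity (f : R -> R) a b : continuity f -> ex_RInt f a b.
Proof. intros H. apply (ex_RInt_continuous (V := R_CompleteNormedModule)). intros. apply continuous_of_continuity_pt, H. Qed.

Lemma RInt_periodic (G : R -> R) t : continuity G -> (forall x, G (x + 1) = G x) ->
  RInt G t (t + 1) = RInt G 0 1.
Proof.
intros HG Hp. assert (EX := fun a b => ex_RInt_continuity G a b HG).
assert (E1 := RInt_Chasles G t 1 (t + 1) (EX _ _) (EX _ _)).
assert (E2 := RInt_Chasles G 0 t 1 (EX _ _) (EX _ _)).
assert (E3 := RInt_comp_lin G 1 1 0 t (EX _ _)).
replace (1 * 0 + 1) with 1 in E3 by ring. replace (1 * t + 1) with (t + 1) in E3 by ring.
rewrite <- E1, <- E2, <- E3.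
rewrite (RInt_ext (fun y => scal 1 (G (1 * y + 1))) G).
- apply Rplus_comm.
- intros x _. change (1 * G (1 * x + 1) = G x). rewrite !Rmult_1_l. apply Hp.
Qed.

(** One [N] must serve every [t], because [jensen] finds its [t] only after [N] is fixed. All nodes
    lie in [[0, 2]], where [G] is uniformly continuous, and by periodicity every window of length
    one has the same integral. *)
Lemma riemann_sum_le (G : R -> R) eta : continuity G -> (forall x, G (x + 1) = G x) -> 0 < eta ->
  exists N, (0 < N)%nat /\ forall t, 0 <= t <= 1 ->
    rsum N (fun j => G (t + INR j / INR N)) <= INR N * (RInt G 0 1 + eta).
Proof.
intros HG Hp He.
destruct (@Heine_cor2 G 0 2 (fun x _ => HG x) (mkposreal eta He)) as [[dl Hdl] HU]. simpl in HU.
destruct (INR_unbounded (/ dl)) as [N HN].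
assert (Hi := Rinv_0_lt_compat _ Hdl).
assert (HN0 : 0 < INR N) by lra.
exists N. split; [apply INR_lt; simpl; lra |].
intros t Ht.
assert (Hstep : / INR N < dl).
{ rewrite <- (Rinv_inv dl). apply Rinv_lt_contravar; [nra | exact HN]. }
assert (HiN : 0 < / INR N) by now apply Rinv_0_lt_compat.
assert (H : forall m, (m <= N)%nat ->
  rsum m (fun j => G (t + INR j / INR N)) <= INR N * RInt G t (t + INR m / INR N) + INR m * eta).
{ induction m; intros Hm.
  - simpl. unfold Rdiv. rewrite Rmult_0_l, Rplus_0_r, RInt_point. unfold zero; simpl. lra.
  - set (a := t + INR m / INR N). set (b := t + INR (S m) / INR N).
    assert (Hab : b - a = / INR N) by (unfold a, b; rewrite S_INR; field; lra).
    assert (HmN : INR (S m) / INR N <= 1).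
    { apply Rmult_le_reg_r with (INR N); [exact HN0 |]. unfold Rdiv.
      rewrite Rmult_assoc, Rinv_l, Rmult_1_r, Rmult_1_l by lra. now apply le_INR. }
    assert (Hma : 0 <= INR m / INR N) by (apply Rmult_le_pos; [apply pos_INR | lra]).
    assert (EX := fun a b => ex_RInt_continuity G a b HG).
    rewrite <- (RInt_Chasles G t a b (EX _ _) (EX _ _)).
    assert (HI : (G a - eta) * / INR N <= RInt G a b).
    { apply Rle_trans with (RInt (fun _ => G a - eta) a b).
      - rewrite RInt_const, Hab. right. apply Rmult_comm.
      - apply RInt_le; [lra | apply ex_RInt_const | apply EX |].
        intros y Hy. unfold a, b in *.
        assert (Hd := HU (t + INR m / INR N) y ltac:(lra) ltac:(lra)
          ltac:(rewrite Rabs_left; lra)).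
        apply Rabs_def2 in Hd. lra. }
    simpl rsum. specialize (IHm ltac:(lia)). fold a in IHm. fold a.
    rewrite S_INR. unfold plus; simpl.
    assert (HM : INR N * ((G a - eta) * / INR N) <= INR N * RInt G a b)
      by (apply Rmult_le_compat_l; lra).
    replace (INR N * ((G a - eta) * / INR N)) with (G a - eta) in HM by (field; lra).
    lra. }
specialize (H N (le_n _)). unfold Rdiv in H at 2. rewrite Rinv_r, RInt_periodic in H by (assumption || lra).
lra.
Qed.

Lemma continuity_ln_Rmax (f : R -> R) e : 0 < e -> continuity f -> continuity (fun x => ln (Rmax (f x) e)).
Proof.
intros He Hf x.
assert (HM : continuity_pt (fun x => Rmax (f x) e) x).
{ apply continuity_pt_ext with (fun x => / 2 * (f x + e + Rabs (f x - e))).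
  - intros t. unfold Rmax. destruct (Rle_dec (f t) e); [rewrite Rabs_left1 | rewrite Rabs_right]; lra.
  - apply (continuity_pt_scal (fun x => f x + e + Rabs (f x - e)) (/ 2)).
    apply (continuity_pt_plus (fun x => f x + e) (fun x => Rabs (f x - e))).
    + apply (continuity_pt_plus f (fct_cte e)); [apply Hf | apply continuity_pt_const; now intros ? ?].
    + apply (continuity_pt_comp (fun x => f x - e) Rabs); [| apply Rcontinuity_abs].
      apply (continuity_pt_minus f (fct_cte e)); [apply Hf | apply continuity_pt_const; now intros ? ?]. }
apply (continuity_pt_comp (fun x => Rmax (f x) e) ln); [exact HM |].
apply derivable_continuous_pt. eexists. apply derivable_pt_lim_ln.
eapply Rlt_le_trans; [exact He | apply Rmax_r].
Qed.

Definition Ccont (f : R -> CC) : Prop :=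
  continuity (fun x => fst (f x)) /\ continuity (fun x => snd (f x)).

Lemma Ccont_const c : Ccont (fun _ => c).
Proof. split; intros x; apply continuity_pt_const; now intros ? ?. Qed.

Lemma Ccont_add f g : Ccont f -> Ccont g -> Ccont (fun x => Cadd (f x) (g x)).
Proof.
intros [F1 F2] [G1 G2]. split; [apply (continuity_plus _ _ F1 G1) | apply (continuity_plus _ _ F2 G2)].
Qed.

Lemma Ccont_opp f : Ccont f -> Ccont (fun x => Copp (f x)).
Proof. intros [F1 F2]. split; [apply (continuity_opp _ F1) | apply (continuity_opp _ F2)]. Qed.

Lemma Ccont_mul f g : Ccont f -> Ccont g -> Ccont (fun x => Cmul (f x) (g x)).
Proof.
intros [F1 F2] [G1 G2]. split.
- apply (continuity_minus _ _ (continuity_mult _ _ F1 G1) (continuity_mult _ _ F2 G2)).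
- apply (continuity_plus _ _ (continuity_mult _ _ F1 G2) (continuity_mult _ _ F2 G1)).
Qed.

Lemma Ccont_sub f g : Ccont f -> Ccont g -> Ccont (fun x => Csub (f x) (g x)).
Proof. intros. apply Ccont_add; [| apply Ccont_opp]; assumption. Qed.

Lemma continuity_affine a b : continuity (fun x => a * x + b).
Proof.
apply derivable_continuous. intros x. exists (a * 1 + 0).
apply (derivable_pt_lim_plus (fun x => a * x) (fct_cte b)).
- apply (derivable_pt_lim_scal id a x 1). apply derivable_pt_lim_id.
- apply derivable_pt_lim_const.
Qed.

Lemma Ccont_em_shift m eps a : Ccont (fun x => em m eps (x + a)).
Proof.
apply Ccont_mul; [apply Ccont_const |].
assert (E : (fun x => cis (PI * IZR m * (x + a))) = (fun x => cis ((PI * IZR m) * x + PI * IZR m * a))).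
{ extensionality x. f_equal. ring. }
rewrite E. split.
- apply (continuity_comp (fun x => PI * IZR m * x + PI * IZR m * a) cos);
    [apply continuity_affine | apply continuity_cos].
- apply (continuity_comp (fun x => PI * IZR m * x + PI * IZR m * a) sin);
    [apply continuity_affine | apply continuity_sin].
Qed.

Lemma Ccont_em m eps : Ccont (fun x => em m eps x).
Proof.
assert (E : (fun x => em m eps x) = (fun x => em m eps (x + 0)))
  by (extensionality x; now rewrite Rplus_0_r).
rewrite E. apply Ccont_em_shift.
Qed.

Lemma Ccont_Csum l (f : Z -> R -> CC) : (forall k, Ccont (f k)) -> Ccont (fun x => Csum l (fun k => f k x)).
Proof.
intros H. induction l; simpl; [apply Ccont_const |]. apply Ccont_add; [apply H | exact IHl].
Qed.

Lemma continuity_sqrt_comp f : continuity f -> continuity (fun x => sqrt (f x)).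
Proof.
intros H x. apply continuity_pt_filterlim. apply (continuous_comp f sqrt).
- apply continuous_of_continuity_pt, H.
- apply continuous_sqrt.
Qed.

Lemma continuity_Cmod f : Ccont f -> continuity (fun x => Cmod (f x)).
Proof.
intros [F1 F2]. apply continuity_sqrt_comp.
apply (continuity_plus _ _ (continuity_mult _ _ F1 F1) (continuity_mult _ _ F2 F2)).
Qed.

Lemma Ccont_pev d : forall p u, Ccont u -> Ccont (fun x => pev d p (u x)).
Proof.
induction d; intros p u Hu; simpl; [apply Ccont_const |].
apply Ccont_add; [apply Ccont_const |]. apply Ccont_mul; [exact Hu | now apply IHd].
Qed.

Lemma Rep_cont h g c eps : Rep h g c -> Ccont (g eps).
Proof.
intros [d [p [_ [_ H]]]].
assert (E : g eps = fun x => pev d p (em h eps x)) by (extensionality x; apply H).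
rewrite E. apply Ccont_pev, Ccont_em.
Qed.

Lemma Rep_periodic g c eps x : Rep 2 g c -> g eps (x + 1) = g eps x.
Proof.
intros [d [p [_ [_ H]]]]. rewrite !H. f_equal. rewrite !em2_cis. f_equal.
unfold cis. replace (2 * PI * (x + 1)) with (2 * PI * x + 2 * INR 1 * PI) by (simpl; ring).
now rewrite cos_period, sin_period.
Qed.

Fixpoint cprod (n : nat) (f : nat -> CC) : CC :=
  match n with O => C1 | S m => Cmul (cprod m f) (f m) end.

Lemma Rep_cprod_shifts h g c (a : nat -> R) N : Rep h g c ->
  Rep h (fun eps x => cprod N (fun j => g eps (x + a j))) (Cpow c N).
Proof.
intros H. induction N; simpl; [apply (Rep_const h C1) |].
replace (Cmul c (Cpow c N)) with (Cmul (Cpow c N) c) by ring.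
apply Rep_mul; [exact IHN | now apply Rep_shift].
Qed.

(* The product of [N] equally spaced translates of [g] has constant coefficient [c ^ N], so
   its modulus reaches [|c| ^ N] somewhere; the corresponding Riemann sum of [log |g|]
   approximates the integral. *)
Lemma jensen g c eps s e : Rep 2 g c -> c <> C0 -> 0 < s -> 0 < e ->
  ln (s * Cmod c) <= RInt (fun x => ln (Rmax (s * Cmod (g eps x)) e)) 0 1.
Proof.
intros Hg Hc Hs He.
set (G := fun x => ln (Rmax (s * Cmod (g eps x)) e)).
assert (HG : continuity G).
{ apply continuity_ln_Rmax; [exact He |]. apply (continuity_scal (fun x => Cmod (g eps x)) s).
  apply continuity_Cmod. now apply (Rep_cont 2 g c). }
assert (Hp : forall x, G (x + 1) = G x).
{ intros x. unfold G. now rewrite (Rep_periodic g c). }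
assert (Hcp := Cmod_pos _ Hc).
apply le_epsilon. intros eta Heta.
destruct (riemann_sum_le G eta HG Hp Heta) as [N [HN HR]].
destruct (Rep_max_modulus _ _ eps (Rep_cprod_shifts 2 g c (fun j => INR j / INR N) N Hg)) as [t [Ht HM]].
specialize (HR t Ht).
assert (HNR : 0 < INR N) by now apply lt_0_INR.
apply Rmult_le_reg_l with (INR N); [exact HNR |].
eapply Rle_trans; [| exact HR].
rewrite Cmod_pow in HM.
(* The truncated logarithm lies above the true one, so the exponential of its sum dominates the
   product even where a factor vanishes. *)
assert (Hprod : forall n, s ^ n * Cmod (cprod n (fun j => g eps (t + INR j / INR N)))
   <= exp (rsum n (fun j => G (t + INR j / INR N)))).
{ induction n; [simpl; rewrite Cmod_C1, exp_0; lra |].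
  simpl rsum. rewrite exp_plus. simpl cprod. rewrite Cmod_mul. simpl pow.
  set (y := t + INR n / INR N). unfold G at 2.
  rewrite exp_ln by (eapply Rlt_le_trans; [exact He | apply Rmax_r]).
  replace (s * s ^ n * (Cmod (cprod n (fun j => g eps (t + INR j / INR N))) * Cmod (g eps y)))
    with (s ^ n * Cmod (cprod n (fun j => g eps (t + INR j / INR N))) * (s * Cmod (g eps y))) by ring.
  apply Rmult_le_compat; [| | exact IHn | apply Rmax_l].
  - apply Rmult_le_pos; [apply pow_le; lra | apply Cmod_ge_0].
  - apply Rmult_le_pos; [lra | apply Cmod_ge_0]. }
specialize (Hprod N).
rewrite <- ln_pow by now apply Rmult_lt_0_compat.
rewrite <- (ln_exp (rsum N (fun j => G (t + INR j / INR N)))).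
assert (H0 : 0 < (s * Cmod c) ^ N) by (apply pow_lt; now apply Rmult_lt_0_compat).
apply ln_le; [exact H0 |].
eapply Rle_trans; [| exact Hprod]. rewrite Rpow_mult_distr.
apply Rmult_le_compat_l; [apply pow_le; lra | exact HM].
Qed.

Definition M2cont (A : R -> M2) : Prop :=
  Ccont (fun x => m11 (A x)) /\ Ccont (fun x => m12 (A x)) /\
  Ccont (fun x => m21 (A x)) /\ Ccont (fun x => m22 (A x)).

Lemma M2cont_mul A B : M2cont A -> M2cont B -> M2cont (fun x => M2mul (A x) (B x)).
Proof.
intros [A1 [A2 [A3 A4]]] [B1 [B2 [B3 B4]]].
repeat split; apply Ccont_add; apply Ccont_mul; assumption.
Qed.

Lemma continuity_Rsqr f : continuity f -> continuity (fun x => Rsqr (f x)).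
Proof. intros H. apply (continuity_mult f f H H). Qed.

Lemma continuity_M2norm A : M2cont A -> continuity (fun x => M2norm (A x)).
Proof.
intros [A1 [A2 [A3 A4]]]. unfold M2norm. cbv zeta.
set (s := fun x => Rsqr (Cmod (m11 (A x))) + Rsqr (Cmod (m12 (A x))) +
  Rsqr (Cmod (m21 (A x))) + Rsqr (Cmod (m22 (A x)))).
set (d := fun x => Cmod (Csub (Cmul (m11 (A x)) (m22 (A x))) (Cmul (m12 (A x)) (m21 (A x))))).
assert (Hs : continuity s).
{ repeat apply (continuity_plus (fun x => _) (fun x => _)); apply continuity_Rsqr, continuity_Cmod; assumption. }
assert (Hd : continuity d).
{ apply continuity_Cmod. apply Ccont_sub; apply Ccont_mul; assumption. }
apply (continuity_sqrt_comp (fun x => (s x + sqrt (Rsqr (s x) - 4 * Rsqr (d x))) / 2)).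
apply (continuity_mult (fun x => s x + sqrt (Rsqr (s x) - 4 * Rsqr (d x))) (fct_cte (/ 2))).
- apply (continuity_plus s _ Hs). apply continuity_sqrt_comp.
  apply (continuity_minus (fun x => Rsqr (s x)) (fun x => 4 * Rsqr (d x))); [now apply continuity_Rsqr |].
  apply (continuity_scal (fun x => Rsqr (d x)) 4). now apply continuity_Rsqr.
- apply continuity_const. now intros ? ?.
Qed.

(** * Logarithmic integrals *)

Lemma Un_cv_le u l b : Un_cv u l -> (exists N, forall n, (N <= n)%nat -> u n <= b) -> l <= b.
Proof.
intros Hu [N HN]. apply Rnot_lt_le. intros H.
destruct (Hu (l - b) ltac:(lra)) as [N' HN'].
specialize (HN (N + N')%nat ltac:(lia)). specialize (HN' (N + N')%nat ltac:(lia)).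
unfold Rdist in HN'. apply Rabs_def2 in HN'. lra.
Qed.

Lemma Un_cv_ge u l b : Un_cv u l -> (forall n, b <= u n) -> b <= l.
Proof.
intros Hu HN. apply Rnot_lt_le. intros H.
destruct (Hu (b - l) ltac:(lra)) as [N' HN'].
specialize (HN N'). specialize (HN' N' ltac:(lia)).
unfold Rdist in HN'. apply Rabs_def2 in HN'. lra.
Qed.

Definition trunc (g : R -> R) (K : nat) : R -> R := fun x => ln (Rmax (g x) (exp (- INR K))).

Lemma is_logint01_ge g I b : is_logint01 g I ->
  (forall K, b <= RInt (trunc g K) 0 1) -> b <= I.
Proof.
intros [J [HJ HI]] H. apply (Un_cv_ge _ _ _ HI). intros K.
destruct (HJ K) as [pr <-]. rewrite <- RInt_Reals. apply H.
Qed.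

Lemma is_logint01_le g I U : continuity g -> is_logint01 g I -> 0 < U -> (forall x, g x <= U) -> I <= ln U.
Proof.
intros Hg [J [HJ HI]] HU H. apply (Un_cv_le _ _ _ HI).
(* Once [exp (- K) <= U], the truncation no longer exceeds [ln U]. *)
destruct (INR_unbounded (- ln U)) as [N HN]. exists N. intros K HK.
destruct (HJ K) as [pr <-]. rewrite <- RInt_Reals.
apply Rle_trans with (RInt (fun _ => ln U) 0 1).
- apply RInt_le; [lra | | apply ex_RInt_const |].
  + apply ex_RInt_continuity, continuity_ln_Rmax; [apply exp_pos | exact Hg].
  + intros x _. apply ln_le; [eapply Rlt_le_trans; [apply exp_pos | apply Rmax_r] |].
    apply Rmax_lub; [apply H |]. rewrite <- (exp_ln U HU).
    apply le_INR in HK.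
    destruct (Req_dec (- INR K) (ln U)) as [-> | Hne]; [lra |]. apply Rlt_le, exp_increasing. lra.
- rewrite RInt_const. unfold scal; simpl. unfold mult; simpl. lra.
Qed.

(** The truncated integrals decrease in [K], and [b] prevents divergence to minus infinity. The
    witness is a [sig], so a sequence of such integrals can be formed without choice. *)
Lemma is_logint01_exists g b : continuity g -> (forall K, b <= RInt (trunc g K) 0 1) ->
  {I | is_logint01 g I}.
Proof.
intros Hg Hb.
assert (HT : forall K, continuity (trunc g K)) by (intros; apply continuity_ln_Rmax; [apply exp_pos | exact Hg]).
destruct (decreasing_cv (fun K => RInt (trunc g K) 0 1)) as [I HI].
- intros K. apply RInt_le; [lra | apply ex_RInt_continuity, HT | apply ex_RInt_continuity, HT |].
  intros x _. apply ln_le; [eapply Rlt_le_trans; [apply exp_pos | apply Rmax_r] |].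
  apply Rle_max_compat_l. rewrite S_INR. apply Rlt_le, exp_increasing. lra.
- exists (- b). intros y [K ->]. unfold opp_seq. specialize (Hb K). lra.
- exists I, (fun K => RInt (trunc g K) 0 1). split; [| exact HI].
  intros K. exists (continuity_implies_RiemannInt Rle_0_1 (fun x _ => HT K x)).
  symmetry. apply RInt_Reals.
Qed.

Lemma AJ_cont M lam N1 N2 mu alpha E eps : M2cont (AJ M lam N1 N2 mu alpha E eps).
Proof.
assert (He : forall k, Ccont (fun x => efun k (x, eps))).
{ intros k. assert (Ef : (fun x => efun k (x, eps)) = (fun x => em (2 * k) eps x))
    by (extensionality x; apply efun_em). rewrite Ef. apply Ccont_em. }
assert (He' : forall k, Ccont (fun x => efun k (x - alpha, eps))).
{ intros k. assert (Ef : (fun x => efun k (x - alpha, eps)) = (fun x => em (2 * k) eps (x + - alpha)))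
    by (extensionality x; apply efun_em). rewrite Ef. apply Ccont_em_shift. }
unfold M2cont, AJ; cbn [m11 m12 m21 m22]. split; [| split; [| split]].
- apply Ccont_sub; [apply Ccont_const |].
  apply (Ccont_Csum _ (fun j x => Cmul (lam j) (efun j (x, eps)))).
  intros. apply Ccont_mul; [apply Ccont_const | apply He].
- apply Ccont_opp.
  apply (Ccont_Csum _ (fun k x => Cmul (Cconj (mu k)) (efun (- k) (x - alpha, eps)))).
  intros. apply Ccont_mul; [apply Ccont_const | apply He'].
- apply (Ccont_Csum _ (fun k x => Cmul (mu k) (efun k (x, eps)))).
  intros. apply Ccont_mul; [apply Ccont_const | apply He].
- apply Ccont_const.
Qed.

Lemma Ccont_comp_shift f a : Ccont f -> Ccont (fun x => f (x + a)).
Proof.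
assert (H : continuity (fun x => x + a)).
{ assert (E : (fun x => x + a) = (fun x => 1 * x + a)) by (extensionality x; ring).
  rewrite E. apply continuity_affine. }
intros [F1 F2]. split.
- apply (continuity_comp (fun x => x + a) (fun x => fst (f x)) H F1).
- apply (continuity_comp (fun x => x + a) (fun x => snd (f x)) H F2).
Qed.

Lemma cocycle_cont A alpha n : M2cont A -> M2cont (cocycle A alpha n).
Proof.
intros HA. induction n.
- split; [| split; [| split]]; [apply (Ccont_const C1) | apply (Ccont_const C0) |
    apply (Ccont_const C0) | apply (Ccont_const C1)].
- apply (M2cont_mul (fun x => A (x + INR n * alpha)) _); [| exact IHn].
  destruct HA as [A1 [A2 [A3 A4]]].
  split; [| split; [| split]]; match goal with |- Ccont (fun x => ?m (A _)) =>
    apply (Ccont_comp_shift (fun x => m (A x))); assumption end.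
Qed.

(** * Lower and upper bounds for the Lyapunov exponent *)

Section Conclusion.
Variables (alpha : R) (M : nat) (lam : Z -> CC) (N1 N2 : Z) (mu : Z -> CC) (E : R).
Hypothesis HN : (N1 < N2)%Z.
Hypothesis Hgap : (N2 - N1 > 2 * Z.of_nat M)%Z.
Hypotheses (Hmu1 : mu N1 <> C0) (Hmu2 : mu N2 <> C0).

Let A eps := AJ M lam N1 N2 mu alpha E eps.
Let L eps := PI * IZR (N2 - N1) * eps + / 2 * (ln (Cmod (mu N1)) + ln (Cmod (mu N2))).

(** Half of Jensen's inequality for the determinant, since [ln M2norm >= ln |det| / 2]. Being
    uniform in [K], it yields both the existence of the integral and its lower bound. *)
Lemma logint_cocycle_lower eps n K :
  INR n * L eps <= RInt (trunc (fun x => M2norm (cocycle (A eps) alpha n x)) K) 0 1.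
Proof.
destruct (det_cocycle_Rep alpha M lam N1 N2 mu E HN n) as [q [Hq Hdet]].
specialize (Hdet eps). fold (A eps) in Hdet.
assert (Hp1 := Cmod_pos _ Hmu1). assert (Hp2 := Cmod_pos _ Hmu2).
set (c := Cpow (Cmul (c12 alpha N1 N2 mu) (mu N1)) n) in *.
assert (Hc : Cmod c = (Cmod (mu N1) * Cmod (mu N2)) ^ n).
{ unfold c. rewrite Cmod_pow, Cmod_mul, Cmod_c12. f_equal. ring. }
assert (Hc0 : c <> C0).
{ intros H. rewrite H, Cmod_C0 in Hc. symmetry in Hc. revert Hc. apply pow_nonzero.
  apply Rgt_not_eq. now apply Rmult_lt_0_compat. }
set (s := exp (2 * PI * IZR (N2 - N1) * eps) ^ n) in *.
assert (Hs : 0 < s) by apply pow_lt, exp_pos.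
set (e := exp (- INR K)). assert (He : 0 < e) by apply exp_pos.
(* The truncation level is squared because the determinant is compared with the square of the
   norm. *)
assert (HJ := jensen q c eps s (e * e) Hq Hc0 Hs ltac:(nra)).
assert (EL : INR n * L eps = / 2 * ln (s * Cmod c)).
{ rewrite Hc. unfold s. rewrite <- Rpow_mult_distr, ln_pow by
    (apply Rmult_lt_0_compat; [apply exp_pos | now apply Rmult_lt_0_compat]).
  rewrite !ln_mult by (try apply exp_pos; try apply Rmult_lt_0_compat; assumption).
  rewrite ln_exp. unfold L. field. }
rewrite EL.
set (G := fun x => ln (Rmax (s * Cmod (q eps x)) (e * e))) in *.
assert (HG : continuity G).
{ apply continuity_ln_Rmax; [nra |]. apply (continuity_scal (fun x => Cmod (q eps x)) s).
  apply continuity_Cmod. now apply (Rep_cont 2 q c). }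
apply Rle_trans with (RInt (fun x => scal (/ 2) (G x)) 0 1).
- rewrite (RInt_scal (V := R_CompleteNormedModule)) by now apply ex_RInt_continuity.
  unfold scal; simpl. unfold mult; simpl. apply Rmult_le_compat_l; [lra | exact HJ].
- apply RInt_le; [lra | | |].
  + apply ex_RInt_continuity. apply (continuity_scal G (/ 2) HG).
  + apply ex_RInt_continuity, continuity_ln_Rmax; [apply exp_pos |].
    apply continuity_M2norm, cocycle_cont, AJ_cont.
  + intros x _. change (/ 2 * G x <= trunc (fun x => M2norm (cocycle (A eps) alpha n x)) K x).
    unfold trunc, G. fold e. set (m := M2norm (cocycle (A eps) alpha n x)).
    assert (Hm : s * Cmod (q eps x) <= m * m) by (rewrite <- Hdet; apply Cmod_det_le).
    assert (Hm0 : 0 <= m) by apply sqrt_pos.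
    assert (Hl := Rmax_l m e). assert (Hr := Rmax_r m e). set (X := Rmax m e) in *.
    assert (HX : ln (Rmax (s * Cmod (q eps x)) (e * e)) <= ln (X * X)).
    { apply ln_le; [eapply Rlt_le_trans; [| apply Rmax_r]; nra |].
      apply Rmax_lub; nra. }
    rewrite ln_mult in HX by lra. lra.
Qed.

(** The bound holds at each finite [n] and passes to the limit; at [eps = 0] the linear term
    disappears. *)
Lemma lyap_lower L0 : is_lyap alpha (A 0) L0 -> / 2 * (ln (Cmod (mu N1)) + ln (Cmod (mu N2))) <= L0.
Proof.
intros [I [HI Hcv]]. apply (Un_cv_ge _ _ _ Hcv). intros n.
assert (Hn : 0 < INR (S n)) by apply lt_0_INR, Nat.lt_0_succ.
apply Rmult_le_reg_r with (INR (S n)); [exact Hn |].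
unfold Rdiv. rewrite (Rmult_assoc (I n)), Rinv_l, Rmult_1_r by lra.
assert (H := is_logint01_ge _ _ _ (HI n) (logint_cocycle_lower 0 (S n))).
unfold L in H. lra.
Qed.

Hypothesis Halpha : irrational alpha.

(** The average over [n] steps lies between [L eps] and [L eps + delta + ln C / n], with [delta]
    arbitrary at fixed [eps]; convergence is thus part of the conclusion. *)
Lemma lyap_large_eps : exists e0, 0 <= e0 /\ forall eps, e0 <= eps -> is_lyap alpha (A eps) (L eps).
Proof.
destruct (cocycle_upper alpha M lam N1 N2 mu E HN Hgap Halpha Hmu1 Hmu2) as [e0 [He0 HU]].
exists e0. split; [exact He0 |]. intros eps Heps. specialize (HU eps Heps).
fold (A eps) in HU.
assert (Hcont : forall n, continuity (fun x => M2norm (cocycle (A eps) alpha n x)))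
  by (intros; apply continuity_M2norm, cocycle_cont, AJ_cont).
set (IX := fun n => is_logint01_exists _ _ (Hcont (S n)) (logint_cocycle_lower eps (S n))).
exists (fun n => proj1_sig (IX n)). split; [intros n; apply (proj2_sig (IX n)) |].
intros eta Heta.
(* Half of [eta] goes to the exponential rate; the other half absorbs [ln C / n] for large [n]. *)
destruct (HU (eta / 2) ltac:(lra)) as [C [HC HB]].
destruct (INR_unbounded (2 * Rabs (ln C) / eta)) as [N HNN].
exists N. intros n Hn.
destruct (IX n) as [I HI]. cbn [proj1_sig].
assert (HSn : 0 < INR (S n)) by apply lt_0_INR, Nat.lt_0_succ.
assert (Hlow := is_logint01_ge _ _ _ HI (logint_cocycle_lower eps (S n))).
assert (Hup : I <= ln C + INR (S n) * (L eps + eta / 2)).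
{ rewrite <- (ln_exp (INR (S n) * (L eps + eta / 2))), <- ln_mult by (auto using exp_pos).
  apply (is_logint01_le _ _ _ (Hcont (S n)) HI).
  - apply Rmult_lt_0_compat; [exact HC | apply exp_pos].
  - intros x. apply HB. }
assert (HlnC : ln C < eta / 2 * INR (S n)).
{ apply Rle_lt_trans with (Rabs (ln C)); [apply Rle_abs |].
  assert (HNn : INR N <= INR (S n)) by (apply le_INR; lia).
  apply Rmult_lt_reg_l with (2 / eta); [apply Rdiv_lt_0_compat; lra |].
  replace (2 / eta * Rabs (ln C)) with (2 * Rabs (ln C) / eta) by (field; lra).
  replace (2 / eta * (eta / 2 * INR (S n))) with (INR (S n)) by (field; lra). lra. }
unfold Rdist.
replace (I / INR (S n) - L eps) with ((I - INR (S n) * L eps) / INR (S n)) by (field; lra).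
rewrite Rabs_right.
- apply Rmult_lt_reg_r with (INR (S n)); [exact HSn |].
  unfold Rdiv. rewrite Rmult_assoc, Rinv_l, Rmult_1_r by lra. lra.
- apply Rle_ge. apply Rmult_le_pos; [lra | apply Rlt_le, Rinv_0_lt_compat, HSn].
Qed.
End Conclusion.

(** * Reflection of the phase *)

Lemma Cconj_add z w : Cconj (Cadd z w) = Cadd (Cconj z) (Cconj w).
Proof. unfold Cconj, Cadd; simpl. f_equal. ring. Qed.

Lemma Cconj_mul z w : Cconj (Cmul z w) = Cmul (Cconj z) (Cconj w).
Proof. unfold Cconj, Cmul; simpl. f_equal; ring. Qed.

Lemma Cconj_opp z : Cconj (Copp z) = Copp (Cconj z).
Proof. reflexivity. Qed.

Lemma Cconj_conj z : Cconj (Cconj z) = z.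
Proof. destruct z. unfold Cconj; simpl. f_equal. ring. Qed.

Lemma Cconj_C0 : Cconj C0 = C0.
Proof. unfold Cconj, C0; simpl. f_equal. ring. Qed.

Lemma Cconj_efun k x eps : Cconj (efun k (x, eps)) = efun (- k) (x, - eps).
Proof.
unfold efun, Cexp, Cconj, Cmul; cbn [fst snd]. rewrite opp_IZR.
replace (0 * x - 2 * PI * - IZR k * - eps) with (0 * x - 2 * PI * IZR k * eps) by ring.
replace (0 * - eps + 2 * PI * - IZR k * x) with (- (0 * eps + 2 * PI * IZR k * x)) by ring.
rewrite cos_neg, sin_neg. f_equal. ring.
Qed.

Lemma Cconj_Csum l f : Cconj (Csum l f) = Csum l (fun k => Cconj (f k)).
Proof. induction l; simpl; [apply Cconj_C0 | now rewrite Cconj_add, IHl]. Qed.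

Lemma Csum_perm l l' f : Permutation l l' -> Csum l f = Csum l' f.
Proof.
induction 1; simpl; [reflexivity | now rewrite IHPermutation | ring | now rewrite IHPermutation1].
Qed.

Lemma Csum_map h l f : Csum (map h l) f = Csum l (fun k => f (h k)).
Proof. induction l; simpl; [reflexivity | now rewrite IHl]. Qed.

(** Negation is a bijection between the two filtered ranges, and both lists are free of duplicates,
    hence permutations of each other. *)
Lemma Csum_zrange_opp a b (P : Z -> bool) f : (forall k, P (- k)%Z = P k) ->
  Csum (List.filter P (zrange (- b) (- a))) f = Csum (List.filter P (zrange a b)) (fun k => f (- k)%Z).
Proof.
intros HP. rewrite <- (Csum_map Z.opp). apply Csum_perm. apply NoDup_Permutation.
- apply NoDup_filter, NoDup_zrange.
- apply FinFun.Injective_map_NoDup; [intros m n H; lia |]. apply NoDup_filter, NoDup_zrange.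
- intros k. rewrite in_map_iff, filter_In, In_zrange. split.
  + intros [H1 H2]. exists (- k)%Z. split; [lia |]. rewrite filter_In, In_zrange, HP. split; [lia | exact H2].
  + intros [j [<- Hj]]. rewrite filter_In, In_zrange in Hj. rewrite HP. split; [lia | apply Hj].
Qed.

Lemma filter_all (l : list Z) : List.filter (fun _ => true) l = l.
Proof. induction l; simpl; [reflexivity | now rewrite IHl]. Qed.

Lemma Csum_zrange_opp_all a b f :
  Csum (zrange (- b) (- a)) f = Csum (zrange a b) (fun k => f (- k)%Z).
Proof.
rewrite <- (filter_all (zrange (- b) (- a))), <- (filter_all (zrange a b)).
now apply Csum_zrange_opp.
Qed.

Definition M2conj (A : M2) : M2 := mkM2 (Cconj (m11 A)) (Cconj (m12 A)) (Cconj (m21 A)) (Cconj (m22 A)).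

Lemma M2conj_mul A B : M2conj (M2mul A B) = M2mul (M2conj A) (M2conj B).
Proof. unfold M2conj, M2mul; cbn [m11 m12 m21 m22]. rewrite !Cconj_add, !Cconj_mul. reflexivity. Qed.

Lemma M2conj_id : M2conj M2id = M2id.
Proof.
unfold M2conj, M2id, Cconj, C0, C1; cbn [m11 m12 m21 m22 fst snd]. rewrite Ropp_0. reflexivity.
Qed.

Lemma M2norm_conj A : M2norm (M2conj A) = M2norm A.
Proof.
unfold M2norm, M2conj; cbn [m11 m12 m21 m22].
rewrite <- !Cconj_mul. unfold Csub. rewrite <- Cconj_opp, <- Cconj_add, !Cmod_conj. reflexivity.
Qed.

Lemma cocycle_conj A alpha n x : cocycle (fun y => M2conj (A y)) alpha n x = M2conj (cocycle A alpha n x).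
Proof.
induction n; simpl; [symmetry; apply M2conj_id | now rewrite IHn, M2conj_mul].
Qed.

(** Coefficients of the trigonometric polynomial that is the complex conjugate on the real line. *)
Definition reflect (f : Z -> CC) : Z -> CC := fun k => Cconj (f (- k)%Z).

(** Conjugation of an exponential reverses its frequency and the sign of [eps]; reindexing by [- k]
    restores the Jacobi form. *)
Lemma AJ_reflect M lam N1 N2 mu alpha E eps x :
  AJ M (reflect lam) (- N2) (- N1) (reflect mu) alpha E (- eps) x = M2conj (AJ M lam N1 N2 mu alpha E eps x).
Proof.
unfold AJ, M2conj; cbn [m11 m12 m21 m22]. f_equal.
- unfold Csub. rewrite Cconj_add, Cconj_opp. f_equal.
  + unfold RtoC, Cconj; simpl. f_equal. ring.
  + f_equal. unfold vpot. rewrite Cconj_Csum.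
    rewrite <- (Z.opp_involutive (Z.of_nat M)) at 2.
    rewrite Csum_zrange_opp by (intros [| k | k]; reflexivity).
    apply Csum_ext. intros j _. unfold reflect.
    now rewrite Cconj_mul, Cconj_efun, !Z.opp_involutive.
- rewrite Cconj_opp. f_equal. unfold ctilde.
  rewrite Cconj_Csum, Csum_zrange_opp_all. apply Csum_ext. intros k _. unfold reflect.
  now rewrite Cconj_mul, Cconj_efun, !Z.opp_involutive.
- unfold cfun. rewrite Cconj_Csum, Csum_zrange_opp_all. apply Csum_ext. intros k _. unfold reflect.
  now rewrite Cconj_mul, Cconj_efun, !Z.opp_involutive.
- symmetry. apply Cconj_C0.
Qed.

(** Entrywise conjugation commutes with products and preserves the operator norm, so both cocycles
    have the same integrals. *)
Lemma is_lyap_reflect M lam N1 N2 mu alpha E eps L0 :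
  is_lyap alpha (AJ M (reflect lam) (- N2) (- N1) (reflect mu) alpha E (- eps)) L0 ->
  is_lyap alpha (AJ M lam N1 N2 mu alpha E eps) L0.
Proof.
intros [I [HI Hcv]]. exists I. split; [| exact Hcv]. intros n. specialize (HI n).
assert (E1 : (fun x => M2norm (cocycle (AJ M (reflect lam) (- N2) (- N1) (reflect mu) alpha E (- eps)) alpha (S n) x))
   = (fun x => M2norm (cocycle (AJ M lam N1 N2 mu alpha E eps) alpha (S n) x))).
{ extensionality x.
  assert (E2 : AJ M (reflect lam) (- N2) (- N1) (reflect mu) alpha E (- eps)
     = (fun y => M2conj (AJ M lam N1 N2 mu alpha E eps y))) by (extensionality y; apply AJ_reflect).
  rewrite E2, cocycle_conj. apply M2norm_conj. }
rewrite <- E1. exact HI.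
Qed.

Theorem mainTheorem9
  (alpha : R) (M : nat) (lam : Z -> CC) (N1 N2 : Z) (mu : Z -> CC)
  (Halpha : irrational alpha)
  (Hlam : forall j : Z, (1 <= Z.abs j <= Z.of_nat M)%Z -> lam (- j)%Z = Cconj (lam j))
  (HN : (N1 < N2)%Z)
  (Hmu1 : mu N1 <> C0) (Hmu2 : mu N2 <> C0)
  (Hgap : (N2 - N1 > 2 * Z.of_nat M)%Z) :
  forall E : R,
    (exists eps0 : R, 0 <= eps0 /\
       forall eps : R, Rabs eps >= eps0 ->
         is_lyap alpha (AJ M lam N1 N2 mu alpha E eps)
           (PI * IZR (N2 - N1) * Rabs eps + / 2 * (ln (Cmod (mu N1)) + ln (Cmod (mu N2))))) /\
    (forall L0 Ic : R,
       is_lyap alpha (AJ M lam N1 N2 mu alpha E 0) L0 ->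
       is_logint01 (fun x => Cmod (cfun N1 N2 mu (x, 0))) Ic ->
       L0 - Ic >= / 2 * (ln (Cmod (mu N1)) + ln (Cmod (mu N2))) - Ic).
Proof.
intros E. split.
- assert (Hr1 : reflect mu (- N2)%Z = Cconj (mu N2)) by (unfold reflect; now rewrite Z.opp_involutive).
  assert (Hr2 : reflect mu (- N1)%Z = Cconj (mu N1)) by (unfold reflect; now rewrite Z.opp_involutive).
  assert (Hnz : forall z, z <> C0 -> Cconj z <> C0).
  { intros z Hz H. apply Hz. rewrite <- (Cconj_conj z), H. apply Cconj_C0. }
  destruct (lyap_large_eps alpha M lam N1 N2 mu E HN Hgap Hmu1 Hmu2 Halpha) as [e1 [He1 H1]].
  (* The reflection keeps the difference [N2 - N1], so the gap condition carries over. *)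
  destruct (lyap_large_eps alpha M (reflect lam) (- N2) (- N1) (reflect mu) E
    ltac:(lia) ltac:(lia) ltac:(rewrite Hr1; auto) ltac:(rewrite Hr2; auto) Halpha) as [e2 [He2 H2]].
  exists (Rmax e1 e2). split; [eapply Rle_trans; [exact He1 | apply Rmax_l] |].
  intros eps Heps. assert (Hl := Rmax_l e1 e2). assert (Hr := Rmax_r e1 e2).
  destruct (Rle_lt_dec 0 eps) as [Hs | Hs].
  + rewrite (Rabs_right eps) in * by lra. apply H1. lra.
  (* Negative [eps] is the reflected problem at [- eps], where the two logarithms appear in the
     other order. *)
  + rewrite (Rabs_left eps) in * by lra. apply is_lyap_reflect.
    specialize (H2 (- eps) ltac:(lra)). rewrite Hr1, Hr2, !Cmod_conj in H2.
    replace (- N1 - - N2)%Z with (N2 - N1)%Z in H2 by lia.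
    rewrite (Rplus_comm (ln (Cmod (mu N1)))). exact H2.
- intros L0 Ic HL _. assert (H := lyap_lower alpha M lam N1 N2 mu E HN Hmu1 Hmu2 L0 HL). lra.
Qed.
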